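(* Let $0<\alpha<1$, let $n\ge 1$ be an integer, $h=1/n$, $x_j=jh$ for $0\le j\le n$, and let $1\le k\le n$. Let $\varphi\in C^3[0,x_k]$, and let $K:[0,1]\times[0,1]\to\mathbb{R}$ be continuous with $|K(x,\tau)|\le M$ for all $0\le x,\tau\le 1$, where $M>0$. Let $F^k(\varphi,h,\alpha)$ be the error at $x_k$ of the Quadratic-linear scheme (S3) for the equation $D^\alpha\varphi(x)=f(x)+\int_0^x K(x,\tau)\varphi(\tau)\,d\tau$. Then: (i) for $k=1$, $$\left|F^1(\varphi,h,\alpha)\right|\le\frac{\alpha}{2\Gamma(3-\alpha)}\max_{x_0\le\tau\le x_1}|\varphi''(\tau)|\,h^{2-\alpha}+\frac{M}{2}\max_{x_0\le\tau\le x_1}|\varphi''(\tau)|\,x_1h^2;$$ (ii) for $k\ge 2$, $$\begin{aligned}\left|F^k(\varphi,h,\alpha)\right|\le{}&\left(\frac{\alpha}{12}\max_{x_0\le\tau\le x_1}|\varphi''(\tau)|\,(x_k-x_1)^{-\alpha-1}h^3+\left[\frac1{12}+\frac{\alpha}{3(1-\alpha)(2-\alpha)}\left(\frac12+\frac1{3-\alpha}\right)\right]\max_{x_0\le\tau\le x_k}\frac{1}{\Gamma(1-\alpha)}|\varphi'''(\tau)|\,h^{3-\alpha}\right)\\&+\frac M2\max_{x_0\le\tau\le x_k}|\varphi''(\tau)|\,x_kh^2 .\end{aligned}$$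
   Context: For $0<\alpha<1$ the Caputo derivative is $D^\alpha\varphi(x)=\frac{1}{\Gamma(1-\alpha)}\int_0^x (x-\tau)^{-\alpha}\varphi'(\tau)\,d\tau$. The problem considered is $D^\alpha\varphi(x)=f(x)+\int_0^x K(x,\tau)\varphi(\tau)\,d\tau$ on $0\le x\le 1$, with $\varphi(0)=\delta$ prescribed. Write $\varphi_j=\varphi(x_j)$. For $0\le j\le k-1$ let $\varphi_{1j}$ be the linear interpolant on $[x_j,x_{j+1}]$, $$\varphi_{1j}(\tau)=\frac{x_{j+1}-\tau}{h}\varphi_j+\frac{\tau-x_j}{h}\varphi_{j+1},$$ and for $2\le j\le k$ let $\varphi_{2j-1}$ be the quadratic interpolant through $(x_{j-2},\varphi_{j-2}),(x_{j-1},\varphi_{j-1}),(x_j,\varphi_j)$, used on $[x_{j-1},x_j]$, $$\varphi_{2j-1}(\tau)=\frac{(\tau-x_{j-1})(\tau-x_j)}{2h^2}\varphi_{j-2}-\frac{(\tau-x_{j-2})(\tau-x_j)}{h^2}\varphi_{j-1}+\frac{(\tau-x_{j-2})(\tau-x_{j-1})}{2h^2}\varphi_j .$$ (Here $\varphi_{1j}$ and $\varphi_{2j-1}$ are names of these interpolants, not nodal values; $\varphi_{10}$ is $\varphi_{1j}$ with $j=0$.) Quadratic-linear scheme (S3): in the equation at $x=x_k$, in the Caputo derivative term replace $\varphi'$ by $\varphi_{10}'$ on $[x_0,x_1]$ and by $\varphi_{2j-1}'$ on $[x_{j-1},x_j]$ for $2\le j\le k$; in the integral term replace $\varphi$ by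 the linear interpolant $\varphi_{1j}$ on each $[x_j,x_{j+1}]$, $0\le j\le k-1$. The error of the scheme at $x_k$ is the error committed by this replacement: $$\begin{aligned}F^k(\varphi,h,\alpha)={}&\frac{1}{\Gamma(1-\alpha)}\left(\int_{x_0}^{x_1}(x_k-\tau)^{-\alpha}\left(\varphi-\varphi_{10}\right)'(\tau)\,d\tau+\sum_{j=2}^{k}\int_{x_{j-1}}^{x_j}(x_k-\tau)^{-\alpha}\left(\varphi-\varphi_{2j-1}\right)'(\tau)\,d\tau\right)\\&-\sum_{j=0}^{k-1}\int_{x_j}^{x_{j+1}}K(x_k,\tau)\left(\varphi(\tau)-\varphi_{1j}(\tau)\right)d\tau ,\end{aligned}$$ where the sum from $j=2$ is empty when $k=1$. *)

(* Defs.v *)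
From mathcomp Require Import all_boot all_order all_algebra.
From mathcomp Require Import all_classical all_reals all_analysis.
Set Implicit Arguments.
Unset Strict Implicit.
Unset Printing Implicit Defensive.
Import Order.TTheory GRing.Theory Num.Theory.
Import numFieldNormedType.Exports.
Local Open Scope classical_set_scope.
Local Open Scope ring_scope.

(* Only meaningful for x > 0, where the integrand is integrable. *)
Definition Gamma (R : realType) (x : R) : R :=
  \int[lebesgue_measure]_(t in `]0, +oo[) (t `^ (x - 1) * expR (- t)).

(* Differentiation relative to a set D: the difference quotient is restricted
   to points of D, so that for D = `[a, b] it is the one-sided derivative at a
   and at b. The library's f^`() would look outside D at these two points. *)
Definition diff_quot (R : realType) (f : R -> R) (x y : R) : R :=
  (f y - f x) / (y - x).

Definition derivable_on (R : realType) (D : set R) (f : R -> R) (x : R) : Prop :=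
  cvg (diff_quot f x y @[y --> within D x^']).

Definition derive_on (R : realType) (D : set R) (f : R -> R) (x : R) : R :=
  lim (diff_quot f x y @[y --> within D x^']).

Definition derive_onn (R : realType) (D : set R) (n : nat) (f : R -> R) : R -> R :=
  iter n (derive_on D) f.

Definition Cn_on (R : realType) (D : set R) (n : nat) (f : R -> R) : Prop :=
  (forall i x, (i < n)%N -> D x -> derivable_on D (derive_onn D i f) x) /\
  {within D, continuous (derive_onn D n f)}.

(* A supremum in general; the maximum when g is continuous on `[a, b], a <= b. *)
Definition max_on (R : realType) (a b : R) (g : R -> R) : R :=
  sup [set g t | t in `[a, b]].

Definition node (R : realType) (h : R) (j : nat) : R := j%:R * h.

(* On [x_j, x_(j+1)]. *)
Definition lin_interp (R : realType) (h : R) (phi : R -> R) (j : nat) (t : R) : R :=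
  (node h j.+1 - t) / h * phi (node h j) +
  (t - node h j) / h * phi (node h j.+1).

(* The quadratic interpolant at x_(j-2), x_(j-1), x_j, for j >= 2, written
   phi_(2 j-1) in the usual notation for the scheme. *)
Definition quad_interp (R : realType) (h : R) (phi : R -> R) (j : nat) (t : R) : R :=
  (t - node h (j - 1)) * (t - node h j) / (2 * h ^+ 2) * phi (node h (j - 2)) -
  (t - node h (j - 2)) * (t - node h j) / h ^+ 2 * phi (node h (j - 1)) +
  (t - node h (j - 2)) * (t - node h (j - 1)) / (2 * h ^+ 2) * phi (node h j).

(* Error at x_k of the quadratic-linear scheme. The kernel (x_k - t)^(- alpha)
   is integrable but unbounded at t = x_k, hence Lebesgue integrals; there
   0 `^ (- alpha) = 0 by convention, which only affects a null set. *)
Definition scheme_error (R : realType) (K : R -> R -> R) (k : nat)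
    (phi : R -> R) (h alpha : R) : R :=
  (Gamma (1 - alpha))^-1 *
    (\int[lebesgue_measure]_(t in `[node h 0, node h 1])
        ((node h k - t) `^ (- alpha) *
         derive_on `[node h 0, node h 1] (phi \- lin_interp h phi 0) t) +
     \sum_(2 <= j < k.+1)
       \int[lebesgue_measure]_(t in `[node h (j - 1), node h j])
         ((node h k - t) `^ (- alpha) *
          derive_on `[node h (j - 1), node h j]
            (phi \- quad_interp h phi j) t)) -
  \sum_(0 <= j < k)
    \int[lebesgue_measure]_(t in `[node h j, node h j.+1])
      (K (node h k) t * (phi t - lin_interp h phi j t)).

(* Main.v *)
Require Import Defs.
From mathcomp Require Import all_boot all_order all_algebra.
From mathcomp Require Import all_classical all_reals all_analysis.
From mathcomp Require Import measurable_realfun ring lra.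
Import Order.TTheory GRing.Theory Num.Theory.
Import numFieldNormedType.Exports.
Local Open Scope classical_set_scope.
Local Open Scope ring_scope.

Set Implicit Arguments.
Unset Strict Implicit.
Unset Printing Implicit Defensive.

(** On a cell [a, b] write E for phi minus its interpolant, which vanishes at the
nodes, and w(t) = (x_k - t)^(-alpha).  Integrating by parts moves the derivative
from E to the weight: the integral of w E' over the cell is minus the integral
of w' E, because w E vanishes at both ends.  This also holds on the last cell,
where w blows up at b = x_k: there |E(t)| <= C (b - t), so w E tends to 0 and
w' E is integrable.  What remains is to bound |E| by the interpolation error and
to integrate alpha (x_k - t)^(-alpha - 1) |E(t)|:

- on the first cell with k = 1, |E| <= M2/2 (t - a)(b - t) leads to a Beta
  integral, equal to h^(2-alpha) / ((1-alpha)(2-alpha)), and the Gamma recurrence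
  turns the denominator times Gamma(1-alpha) into Gamma(3-alpha);
- on the first cell with k >= 2, the weight is at most (x_k - x_1)^(-alpha-1)
  and (t - a)(b - t) integrates to h^3/6.  Here the factor 1/Gamma(1-alpha) is
  absorbed by Gamma(1-alpha) >= 1;
- on the cells 2 <= j < k, |E| <= M3 h^3/12, so the contributions telescope to
  at most M3/12 h^3 (x_k - x_(k-1))^(-alpha) = M3/12 h^(3-alpha);
- on the last cell, |E| <= M3/6 (t - x_(k-2))(t - x_(k-1))(x_k - t) gives the
  rational constant of the statement.

The kernel term is bounded pointwise by M times M2/2 h^2.

Every integral over a cell is handled by one comparison principle,
[Rintegral_dist_primitive]: if |f - F'| <= G' on the open segment, then the
integral of f differs from F(b) - F(a) by at most G(b) - G(a).  Taking F = w E
and for G an explicit primitive of the majorant performs the integration by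
parts and the evaluation of the majorant in one step
([Rintegral_weight_le]).  The interpolation errors come from
[interpolation_error] (iterated Rolle), and the two facts on Gamma are [GammaS]
and [Gamma_ge1]. *)

(** * Comparing an integral with a primitive *)

Lemma is_derive_continuous (R : realType) (f : R -> R) (x d : R) :
  is_derive x 1 f d -> {for x, continuous f}.
Proof.
by case=> dx _; apply: differentiable_continuous; apply/derivable1_diffP.
Qed.

(** The function F minus the indefinite integral of f is continuous on the closed
segment and has derivative F' - f >= 0 inside, hence does not decrease.  Neither
f nor F' is assumed bounded, so the principle covers improper integrals. *)
Lemma Rintegral_le_primitive (R : realType) (f F dF : R -> R) (a b : R) :
  a <= b ->
  lebesgue_measure.-integrable `[a, b] (EFin \o f) ->
  (forall x, x \in `]a, b[%R -> {for x, continuous f}) ->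
  {within `[a, b], continuous F} ->
  (forall x, x \in `]a, b[%R -> is_derive x 1 F (dF x)) ->
  (forall x, x \in `]a, b[%R -> f x <= dF x) ->
  \int[lebesgue_measure]_(t in `[a, b]) f t <= F b - F a.
Proof.
move=> ab intf cf cF dFE lef.
pose G x := \int[lebesgue_measure]_(t in `[a, x]) f t.
have cG : {within `[a, b], continuous G} by exact: parameterized_integral_continuous.
have dG x : x \in `]a, b[%R -> is_derive x 1 (F - G) (dF x - f x).
  move=> xab; have /andP[ax xb] : a < x < b by move: xab; rewrite in_itv.
  have [dGx Gx] := continuous_FTC1_closed xb intf ax (cf x xab).
  have FGx := dFE x xab.
  have Gd : is_derive x 1 G (f x) by apply: DeriveDef; [exact: dGx | rewrite -derive1E; exact: Gx].
  exact: is_deriveB.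
have cFG : {within `[a, b], continuous (F - G)}.
  by move=> x; apply: cvgB; [exact: cF | exact: cG].
rewrite -/(G b) -subr_ge0.
have -> : F b - F a - G b = (F - G) b - (F - G) a.
  have Ga : G a = 0 by rewrite /G set_itv1 Rintegral_set1.
  by rewrite !fctE Ga subr0 addrAC.
move: (ab); rewrite le_eqVlt => /predU1P[->|ltab]; first by rewrite subrr.
have [c cab ->] := MVT ltab dG cFG.
by rewrite mulr_ge0 ?subr_ge0 ?lef// ltW.
Qed.

Lemma Rintegral_ge_primitive (R : realType) (f F dF : R -> R) (a b : R) :
  a <= b ->
  lebesgue_measure.-integrable `[a, b] (EFin \o f) ->
  (forall x, x \in `]a, b[%R -> {for x, continuous f}) ->
  {within `[a, b], continuous F} ->
  (forall x, x \in `]a, b[%R -> is_derive x 1 F (dF x)) ->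
  (forall x, x \in `]a, b[%R -> dF x <= f x) ->
  F b - F a <= \int[lebesgue_measure]_(t in `[a, b]) f t.
Proof.
move=> ab intf cf cF dFE gef.
have intN : \int[lebesgue_measure]_(t in `[a, b]) (- f) t =
    - \int[lebesgue_measure]_(t in `[a, b]) f t.
  rewrite -[RHS]mulN1r -RintegralZl//.
  by apply: eq_Rintegral => x _; rewrite mulN1r.
rewrite -lerN2 -intN (_ : - (F b - F a) = (- F) b - (- F) a); last first.
  by rewrite opprB [RHS]addrC; congr (_ + _); exact/esym/opprK.
apply: (@Rintegral_le_primitive _ _ _ (- dF)) => //.
- exact: integrableN intf.
- by move=> x xab; apply: cvgN; exact: cf.
- by move=> x; apply: cvgN; exact: cF.
- by move=> x xab; have dFx := dFE x xab; exact: is_deriveN.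
- by move=> x xab; rewrite lerN2 gef.
Qed.

Lemma Rintegral_primitive (R : realType) (f F : R -> R) (a b : R) :
  a <= b ->
  lebesgue_measure.-integrable `[a, b] (EFin \o f) ->
  (forall x, x \in `]a, b[%R -> {for x, continuous f}) ->
  {within `[a, b], continuous F} ->
  (forall x, x \in `]a, b[%R -> is_derive x 1 F (f x)) ->
  \int[lebesgue_measure]_(t in `[a, b]) f t = F b - F a.
Proof.
move=> ab intf cf cF dF; apply/eqP; rewrite eq_le; apply/andP; split.
  exact: (@Rintegral_le_primitive _ _ _ f).
exact: (@Rintegral_ge_primitive _ _ _ f).
Qed.

Lemma Rintegral_dist_primitive (R : realType) (f F dF G dG : R -> R) (a b : R) :
  a <= b ->
  lebesgue_measure.-integrable `[a, b] (EFin \o f) ->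
  (forall x, x \in `]a, b[%R -> {for x, continuous f}) ->
  {within `[a, b], continuous F} ->
  (forall x, x \in `]a, b[%R -> is_derive x 1 F (dF x)) ->
  {within `[a, b], continuous G} ->
  (forall x, x \in `]a, b[%R -> is_derive x 1 G (dG x)) ->
  (forall x, x \in `]a, b[%R -> `|f x - dF x| <= dG x) ->
  `|\int[lebesgue_measure]_(t in `[a, b]) f t - (F b - F a)| <= G b - G a.
Proof.
move=> ab intf cf cF dFE cG dGE fFG.
have cFG : {within `[a, b], continuous (F + G)}.
  by move=> x; apply: cvgD; [exact: cF | exact: cG].
have cFG' : {within `[a, b], continuous (F - G)}.
  by move=> x; apply: cvgB; [exact: cF | exact: cG].
have dFG x : x \in `]a, b[%R -> is_derive x 1 (F + G) (dF x + dG x).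
  by move=> xab; have h1 := dFE x xab; have h2 := dGE x xab; exact: is_deriveD.
have dFG' x : x \in `]a, b[%R -> is_derive x 1 (F - G) (dF x - dG x).
  by move=> xab; have h1 := dFE x xab; have h2 := dGE x xab; exact: is_deriveB.
have := @Rintegral_le_primitive _ _ _ _ _ _ ab intf cf cFG dFG _.
have := @Rintegral_ge_primitive _ _ _ _ _ _ ab intf cf cFG' dFG' _.
rewrite !fctE => lb ub; rewrite ler_distl; apply/andP; split.
  apply: le_trans (lb _) => [|x /fFG]; first by lra.
  by rewrite ler_distl => /andP[].
apply: le_trans (ub _) _ => [x /fFG|]; last by lra.
by rewrite ler_distl => /andP[].
Qed.

(** * Integrals over an increasing union of segments *)

Section exhaustion.
Variables (R : realType) (u v : nat -> R) (D : set R) (f : R -> R).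
Hypothesis uv : forall n, u n <= v n.
Hypothesis u_nincr : forall n, u n.+1 <= u n.
Hypothesis v_ndecr : forall n, v n <= v n.+1.
Hypothesis Duv : D = \bigcup_n `[u n, v n]%classic.
Hypothesis cf : forall x, D x -> {for x, continuous f}.

Local Notation mu := (@lebesgue_measure R).

Let subD n : `[u n, v n]%classic `<=` D.
Proof. by rewrite Duv => x xn; exists n. Qed.

Let intf_seg (g : R -> R) n : (forall x, D x -> {for x, continuous g}) ->
  mu.-integrable `[u n, v n] (EFin \o g).
Proof.
move=> cg; apply: continuous_compact_integrable; first exact: segment_compact.
by apply: continuous_in_subspaceT => x; rewrite inE => /subD; exact: cg.
Qed.

Let mD : measurable D.
Proof. by rewrite Duv; apply: bigcupT_measurable. Qed.

Let mf_seg (g : R -> R) n : (forall x, D x -> {for x, continuous g}) ->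
  measurable_fun `[u n, v n] g.
Proof. by move=> cg; apply/measurable_EFinP; exact: measurable_int (intf_seg n cg). Qed.

Let mfD (g : R -> R) : (forall x, D x -> {for x, continuous g}) -> measurable_fun D g.
Proof.
by move=> cg; rewrite Duv; apply/measurable_fun_bigcup => // n; exact: mf_seg.
Qed.

Let nd_seg : nondecreasing_seq (fun n => `[u n, v n]%classic : set R).
Proof.
apply/nondecreasing_seqP => n; apply/subsetPset; apply: subset_itv.
  by rewrite bnd_simp.
by rewrite bnd_simp.
Qed.

Lemma cvg_Rintegral_exhaustion : (forall x, D x -> 0 <= f x) ->
  mu.-integrable D (EFin \o f) ->
  \int[mu]_(t in `[u n, v n]) f t @[n --> \oo] --> \int[mu]_(t in D) f t.
Proof.
move=> f0 intf; apply: fine_cvg.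
rewrite fineK; last exact: integrable_fin_num.
rewrite Duv; apply: ge0_nondecreasing_set_cvg_integral => //.
- by move=> n; apply/measurable_EFinP; exact: mf_seg.
- by move=> n x /subD Dx; rewrite lee_fin f0.
Qed.

(** Integrability test: a primitive of a majorant of |f| with bounded increments
along the exhaustion bounds the integrals of |f| over the segments. *)
Lemma integrable_exhaustion (F dF : R -> R) (C : R) :
  (forall x, D x -> is_derive x 1 F (dF x)) ->
  (forall x, D x -> `|f x| <= dF x) ->
  (forall n, F (v n) - F (u n) <= C) ->
  mu.-integrable D (EFin \o f).
Proof.
move=> dFE lef FC.
have cnf x : D x -> {for x, continuous (fun t => `|f t|)}.
  by move=> Dx; apply: cvg_norm; exact: cf.
apply/integrableP; split; first by apply/measurable_EFinP; exact: mfD.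
have cv : (\int[mu]_(x in `[u n, v n]) `|(f x)%:E| @[n --> \oo] -->
    \int[mu]_(x in D) `|(f x)%:E|)%E.
  rewrite Duv; apply: ge0_nondecreasing_set_cvg_integral => // n.
  by apply: measurableT_comp => //; apply/measurable_EFinP; exact: mf_seg.
apply: (@le_lt_trans _ _ C%:E); last by rewrite ltry.
rewrite -(cvg_lim _ cv)//; apply: lime_le; first by apply/cvg_ex; eexists; exact: cv.
near=> n.
have ifn := intf_seg n cnf.
rewrite (_ : (\int[mu]_(x in _) _)%E = (\int[mu]_(x in `[u n, v n]) `|f x|)%:E).
  rewrite lee_fin (le_trans _ (FC n))//.
  apply: (@Rintegral_le_primitive _ _ _ dF) => //.
  + by move=> x xuv; apply: cnf; apply: (@subD n); exact: subset_itv_oo_cc.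
  + apply: continuous_in_subspaceT => x; rewrite inE => /subD Dx.
    exact: is_derive_continuous (dFE x Dx).
  + by move=> x xuv; apply: dFE; apply: (@subD n); exact: subset_itv_oo_cc.
  + by move=> x xuv; apply: lef; apply: (@subD n); exact: subset_itv_oo_cc.
by rewrite /Rintegral fineK//; exact: integrable_fin_num.
Unshelve. all: by end_near. Qed.

End exhaustion.

(** * Two facts on the Gamma function *)

Section gamma.
Variable R : realType.
Local Notation mu := (@lebesgue_measure R).
Implicit Types (s t : R).

Let u (n : nat) : R := n.+1%:R^-1.
Let v (n : nat) : R := n.+1%:R.

(* The half-line is exhausted by the segments [1/(n+1), n+1]. *)
Let bigcup_uv : `]0, +oo[%classic = \bigcup_n `[u n, v n]%classic.
Proof.
apply/seteqP; split => [t|t [n _]] /=; rewrite !in_itv /= ?andbT.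
- move=> t0; exists (Num.truncn t + Num.truncn t^-1)%N => //=.
  rewrite in_itv /=; apply/andP; split.
    rewrite -[leRHS]invrK lef_pV2 ?posrE ?invr_gt0// (le_trans (ltW (truncnS_gt _)))//.
    by rewrite ler_nat ltnS leq_addl.
  by rewrite (le_trans (ltW (truncnS_gt _)))// ler_nat ltnS leq_addr.
- by move=> /andP[+ _]; apply: lt_le_trans; rewrite invr_gt0.
Qed.

Let uv n : u n <= v n.
Proof. by rewrite (@le_trans _ _ 1)// /u /v ?invf_le1 ?ler1n. Qed.

Let u_nincr n : u n.+1 <= u n.
Proof. by rewrite /u lef_pV2 ?posrE// ler_nat. Qed.

Let v_ndecr n : v n <= v n.+1.
Proof. by rewrite /v ler_nat. Qed.

Lemma powR_le1Dsq t s : 0 < t -> 0 <= s <= 2 -> t `^ s <= 1 + t ^+ 2.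
Proof.
move=> t0 /andP[s0 s2]; have [t1|t1] := leP t 1.
  rewrite (@le_trans _ _ 1)//; last by rewrite lerDl sqr_ge0.
  have := @ge0_ler_powR R s s0 t 1; rewrite powR1; apply => //.
  by rewrite nnegrE ltW.
  by rewrite nnegrE.
rewrite (@le_trans _ _ (t ^+ 2))//; last by rewrite lerDr.
by rewrite -powR_mulrn; [apply: ler_powR; first exact: ltW | exact: ltW].
Qed.

Lemma sq_le_expR t : 0 <= t -> 1 + t ^+ 2 <= 2 * expR t.
Proof.
move=> t0; have := expR_ge1Dxn 1 t0; rewrite (_ : 2`! = 2)%N//; lra.
Qed.

Lemma cube_le_expR t : 0 <= t -> t ^+ 3 <= 6 * expR t.
Proof.
move=> t0; have := expR_ge1Dxn 2 t0; rewrite (_ : 3`! = 6)%N//; lra.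
Qed.

Let f s t := t `^ (s - 1) * expR (- t).

Lemma is_derive_expRN t : is_derive t 1 (fun x : R => expR (- x)) (- expR (- t)).
Proof.
by apply: trigger_derive; rewrite ?mulrN1 ?scaleN1r//=.
Qed.

Lemma is_derive_powR_expRN s t : 0 < t ->
  is_derive t 1 (fun x => x `^ s * expR (- x)) (s * f s t - f (s + 1) t).
Proof.
move=> t0; have h1 := is_derive1_powR s t0; have h2 := is_derive_expRN t.
apply: trigger_derive.
rewrite /f addrK /GRing.scale /=; ring.
Qed.

(** Since t^s <= 1 + t^2 for 0 <= s <= 2, this is a bounded primitive of a
majorant of the Gamma integrand with exponent s. *)
Lemma is_derive_sq_expRN t :
  is_derive t 1 (fun x : R => - (x ^+ 2 + 2 * x + 3) * expR (- x))
    ((1 + t ^+ 2) * expR (- t)).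
Proof.
have h := is_derive_expRN t; apply: trigger_derive.
rewrite /GRing.scale /=; ring.
Qed.

Let cf s t : t \in `]0, +oo[%classic -> {for t, continuous (f s)}.
Proof.
rewrite inE /= in_itv /= andbT => t0; apply: cvgM.
  exact: (is_derive_continuous (is_derive1_powR (s - 1) t0)).
exact: (is_derive_continuous (is_derive_expRN t)).
Qed.

Let f_ge0 s t : 0 <= f s t.
Proof. by rewrite mulr_ge0 ?powR_ge0 ?expR_ge0. Qed.

Let u01 n : 0 < u n <= 1.
Proof. by rewrite invr_gt0 ltr0n /= /u invf_le1 ?ler1n. Qed.

Let gt0E t : `]0, +oo[%classic t -> 0 < t.
Proof. by rewrite /= in_itv /= andbT. Qed.

Lemma quad_expRN_le t : 0 <= t <= 1 -> (t ^+ 2 + 2 * t + 3) * expR (- t) <= 6.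
Proof.
move=> /andP[t0 t1].
have e1 : expR (- t) <= 1 by rewrite -[leRHS]expR0 ler_expR oppr_le0.
have e0 := expR_ge0 (- t).
apply: (@le_trans _ _ (6 * expR (- t))); last lra.
by apply: ler_wpM2r => //; nra.
Qed.

Lemma integrable_gamma_ge1 s : 1 <= s <= 3 -> mu.-integrable `]0, +oo[ (EFin \o f s).
Proof.
move=> s13; apply: (integrable_exhaustion uv u_nincr v_ndecr bigcup_uv _
  (F := fun t => - (t ^+ 2 + 2 * t + 3) * expR (- t))
  (dF := fun t => (1 + t ^+ 2) * expR (- t)) (C := 6)).
- by move=> t t0; apply: cf; rewrite inE.
- by move=> t _; exact: is_derive_sq_expRN.
- move=> t /gt0E t0; rewrite ger0_norm// ler_wpM2r ?expR_ge0// powR_le1Dsq//; lra.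
- move=> n; rewrite !mulNr opprK addrC lerBlDr; apply: ler_wpDr.
    by rewrite mulr_ge0 ?expR_ge0// !addr_ge0 ?sqr_ge0 ?mulr_ge0 /v.
  by have /andP[u0 u1] := u01 n; rewrite quad_expRN_le// u1 ltW.
Qed.

(** For exponents below 1 the integrand is unbounded at 0; as
s t^(s-1) e^(-t) = (t^s e^(-t))' + t^s e^(-t), it still has a majorant with
bounded primitive. *)
Lemma integrable_gamma s : 0 < s <= 2 -> mu.-integrable `]0, +oo[ (EFin \o f s).
Proof.
move=> /andP[s0 s2]; apply: (integrable_exhaustion uv u_nincr v_ndecr bigcup_uv _
  (F := fun t => s^-1 * (t `^ s * expR (- t) + - (t ^+ 2 + 2 * t + 3) * expR (- t)))
  (dF := fun t => s^-1 * ((s * f s t - f (s + 1) t) + (1 + t ^+ 2) * expR (- t)))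
  (C := s^-1 * 8)).
- by move=> t t0; apply: cf; rewrite inE.
- move=> t /gt0E t0; have h1 := is_derive_sq_expRN t; have h2 := is_derive_powR_expRN s t0.
  by apply: trigger_derive.
- move=> t /gt0E t0; rewrite ger0_norm// mulrDr mulrBr mulKf ?gt_eqF// -addrA lerDl.
  rewrite addrC -mulrBr mulr_ge0 ?invr_ge0 ?(ltW s0)// subr_ge0.
  by rewrite /f addrK ler_wpM2r ?expR_ge0// powR_le1Dsq// ltW.
- move=> n; rewrite -mulrBr ler_pM2l ?invr_gt0//.
  have /andP[u0 u1] := u01 n.
  have := @quad_expRN_le (u n); rewrite (ltW u0) u1 => /(_ isT).
  have : v n `^ s * expR (- v n) <= 2.
    apply: (@le_trans _ _ ((1 + v n ^+ 2) * expR (- v n))).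
      by rewrite ler_wpM2r ?expR_ge0// powR_le1Dsq ?ltr0n// (ltW s0).
    by rewrite expRN ler_pdivrMr ?expR_gt0// sq_le_expR// /v.
  have : 0 <= u n `^ s * expR (- u n) by rewrite mulr_ge0 ?powR_ge0 ?expR_ge0.
  have : 0 <= (v n ^+ 2 + 2 * v n + 3) * expR (- v n).
    by rewrite mulr_ge0 ?expR_ge0// !addr_ge0 ?sqr_ge0 ?mulr_ge0 /v.
  rewrite !mulNr; lra.
Qed.

Let cvg_Gamma s : mu.-integrable `]0, +oo[ (EFin \o f s) ->
  \int[mu]_(t in `[u n, v n]) f s t @[n --> \oo] --> Gamma s.
Proof.
move=> fi; have := cvg_Rintegral_exhaustion (f := f s) u_nincr v_ndecr bigcup_uv.
by apply => // t t0; apply: cf; rewrite inE.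
Qed.

Let cvg_inv6 : 6 * u n @[n --> \oo] --> (0 : R).
Proof.
by rewrite -[X in _ --> X](mulr0 6); apply: cvgM; [exact: cvg_cst | exact: cvg_harmonic].
Qed.

Let cvg_powR_expRN_v s : 0 <= s <= 2 -> v n `^ s * expR (- v n) @[n --> \oo] --> 0.
Proof.
move=> /andP[s0 s2]; apply: (squeeze_cvgr _ (cvg_cst 0) cvg_inv6).
near=> n; rewrite mulr_ge0 ?powR_ge0 ?expR_ge0//=.
have v1 : 1 <= v n by rewrite ler1n.
rewrite expRN ler_pdivrMr ?expR_gt0// mulrAC ler_pdivlMr ?ltr0n//.
apply: le_trans (cube_le_expR (le_trans ler01 v1)).
rewrite exprSr ler_wpM2r ?(le_trans ler01 v1)//.
by rewrite -powR_mulrn ?(le_trans ler01 v1)//; exact: ler_powR.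
Unshelve. all: by end_near. Qed.

Let cvg_u : u n @[n --> \oo] --> (0 : R).
Proof. exact: cvg_harmonic. Qed.

Let cvg_expRN_u : expR (- u n) @[n --> \oo] --> (1 : R).
Proof.
rewrite -expR0; apply: (@cvg_comp _ _ _ (fun n => - u n) expR); last exact: continuous_expR.
by rewrite -oppr0; apply: cvgN; exact: cvg_u.
Qed.

Let cvg_powR_expRN_u s : 0 < s -> u n `^ s * expR (- u n) @[n --> \oo] --> 0.
Proof.
move=> s0; rewrite -(mul0r (1 : R)); apply: cvgM; last exact: cvg_expRN_u.
apply: ((cvg_at_rightP _ _ _).1 (powR_cvg0 s0)); split => [n|]; last exact: cvg_u.
by have /andP[] := u01 n.
Qed.

Let integrable_seg (g : R -> R) n :
  (forall t, t \in `]0, +oo[%classic -> {for t, continuous g}) ->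
  mu.-integrable `[u n, v n] (EFin \o g).
Proof.
move=> cg; apply: continuous_compact_integrable; first exact: segment_compact.
apply: continuous_in_subspaceT => t; rewrite inE => tuv; apply: cg.
by rewrite inE bigcup_uv; exists n.
Qed.

Let sub_oo n t : t \in `]u n, v n[ -> `]0, +oo[%classic t.
Proof. by move=> tuv; rewrite bigcup_uv; exists n => //; exact: subset_itv_oo_cc. Qed.

(** Integration by parts: s t^(s-1) e^(-t) - t^s e^(-t) is the derivative of
t^s e^(-t), which tends to 0 at both ends of the half-line. *)
Lemma GammaS s : 0 < s <= 2 -> Gamma (s + 1) = s * Gamma s.
Proof.
move=> s02; have /andP[s0 s2] := s02.
have is1 := integrable_gamma s02.
have is2 : mu.-integrable `]0, +oo[ (EFin \o f (s + 1)) by apply: integrable_gamma_ge1; lra.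
pose F t := t `^ s * expR (- t).
have FE n : s * \int[mu]_(t in `[u n, v n]) f s t -
    \int[mu]_(t in `[u n, v n]) f (s + 1) t = F (v n) - F (u n).
  have iS r : mu.-integrable `[u n, v n] (EFin \o f r) by apply: integrable_seg => t; exact: cf.
  have csf t : t \in `]0, +oo[%classic -> {for t, continuous (fun x => s * f s x)}.
    by move=> t0; apply: cvgM; [exact: cvg_cst | exact: cf].
  have ch t : t \in `]0, +oo[%classic ->
      {for t, continuous (fun x => s * f s x - f (s + 1) x)}.
    by move=> t0; apply: cvgB; [exact: csf | exact: cf].
  rewrite -RintegralZl// -RintegralB//; last exact: integrable_seg.
  apply: (@Rintegral_primitive _ (fun t => s * f s t - f (s + 1) t)) => //.
  - exact: integrable_seg.
  - by move=> t /sub_oo t0; apply: ch; rewrite inE.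
  - apply: continuous_in_subspaceT => t; rewrite inE => tuv.
    have /gt0E t0 : `]0, +oo[%classic t by rewrite bigcup_uv; exists n.
    exact: is_derive_continuous (is_derive_powR_expRN s t0).
  - by move=> t /sub_oo/gt0E t0; exact: is_derive_powR_expRN.
have lim1 : F (v n) - F (u n) @[n --> \oo] --> s * Gamma s - Gamma (s + 1).
  rewrite -(funext FE).
  exact: cvgB (cvgM (cvg_cst s) (cvg_Gamma is1)) (cvg_Gamma is2).
have lim2 : F (v n) - F (u n) @[n --> \oo] --> (0 - 0 : R).
  by apply: cvgB; [apply: cvg_powR_expRN_v; rewrite (ltW s0) | exact: cvg_powR_expRN_u].
apply/eqP; rewrite eq_sym -subr_eq0; apply/eqP.
by rewrite (cvg_unique _ lim1 lim2)// subr0.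
Qed.

Lemma powR_ge_tangent (a t : R) : 0 < t -> 0 <= a -> 1 + a - a * t <= t `^ (- a).
Proof.
move=> t0 a0; rewrite /powR gt_eqF// (le_trans _ (expR_ge1Dx _))//.
have lnt : ln t <= t - 1.
  have : ln (1 + (t - 1)) <= t - 1 by apply: le_ln1Dx; lra.
  by rewrite addrC subrK.
nra.
Qed.

(** By convexity t^(-a) lies above its tangent 1 + a - a t at t = 1, and the
integral of (1 + a - a t) e^(-t) over the half-line is 1. *)
Lemma Gamma_ge1 (a : R) : 0 < a < 1 -> 1 <= Gamma (1 - a).
Proof.
move=> /andP[a0 a1].
have ia : mu.-integrable `]0, +oo[ (EFin \o f (1 - a)) by apply: integrable_gamma; lra.
(* A primitive of (1 + a - a t) e^(-t). *)
pose F t := t * expR (- t) * a - expR (- t).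
have dF t : is_derive t 1 F ((1 + a - a * t) * expR (- t)).
  have h := is_derive_expRN t; apply: trigger_derive.
  rewrite /GRing.scale /=; ring.
have lb n : F (v n) - F (u n) <= \int[mu]_(t in `[u n, v n]) f (1 - a) t.
  apply: (@Rintegral_ge_primitive _ _ _ (fun t => (1 + a - a * t) * expR (- t))) => //.
  - by apply: integrable_seg => t; exact: cf.
  - by move=> t /sub_oo t0; apply: cf; rewrite inE.
  - by apply: continuous_in_subspaceT => t _; exact: is_derive_continuous (dF t).
  - move=> t /sub_oo/gt0E t0; rewrite /f ler_wpM2r ?expR_ge0//.
    by rewrite (_ : 1 - a - 1 = - a) ?powR_ge_tangent ?ltW//; ring.
have cF : F (v n) - F (u n) @[n --> \oo] --> (0 * a - 0 - (0 * 1 * a - 1) : R).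
  have ve : expR (- v n) @[n --> \oo] --> 0.
    have h02 : 0 <= (0 : R) <= 2 by lra.
    have := cvg_powR_expRN_v h02.
    by under eq_fun do rewrite powRr0 mul1r.
  have vte : v n * expR (- v n) @[n --> \oo] --> 0.
    have h12 : 0 <= (1 : R) <= 2 by lra.
    have := cvg_powR_expRN_v h12.
    by under eq_fun do rewrite powRr1 ?ler0n//.
  apply: cvgB; apply: cvgB => //; first by apply: cvgM => //; exact: cvg_cst.
  by apply: cvgM; [apply: cvgM | exact: cvg_cst].
have e : 0 * a - 0 - (0 * 1 * a - 1) = 1 :> R by ring.
rewrite e in cF.
exact: (ler_cvg_to cF (cvg_Gamma ia) (nearW _ lb)).
Qed.

Lemma Gamma_3B (a : R) : 0 < a < 1 ->
  Gamma (3 - a) = (1 - a) * (2 - a) * Gamma (1 - a).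
Proof.
move=> /andP[a0 a1].
have -> : 3 - a = 2 - a + 1 by ring.
rewrite GammaS; last by apply/andP; split; lra.
have -> : 2 - a = 1 - a + 1 by ring.
rewrite GammaS; last by apply/andP; split; lra.
by ring.
Qed.

End gamma.

(** * The error of polynomial interpolation *)

(** The output is again a strictly increasing sequence of zeros, with first point
beyond x, so that the lemma can be iterated on the successive derivatives. *)
Lemma Rolle_zeros (R : realType) (f df : R -> R) (a b : R) :
  {within `[a, b], continuous f} ->
  (forall x, x \in `]a, b[%R -> is_derive x 1 f (df x)) ->
  forall (s : seq R) (x : R), path <%R x s ->
    (forall y, y \in x :: s -> y \in `[a, b]%R /\ f y = 0) ->
  exists s' : seq R, [/\ size s' = size s, path <%R x s' &
    forall y, y \in s' -> y \in `[a, b]%R /\ df y = 0].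
Proof.
move=> cf fdf; elim=> [x _ _|y s IH x /= /andP[xy pys] zs].
  by exists [::].
have [|s' [ss' ps' zs']] := IH y pys.
  by move=> z zys; apply: zs; rewrite inE zys orbT.
have [xab fx0] := zs x (mem_head _ _).
have [yab fy0] : y \in `[a, b]%R /\ f y = 0 by apply: zs; rewrite !inE eqxx orbT.
have sub z : z \in `]x, y[%R -> z \in `]a, b[%R.
  move: xab yab; rewrite !in_itv /= => /andP[ax xb] /andP[ay yb] /andP[xz zy].
  by rewrite (le_lt_trans ax xz) (lt_le_trans zy yb).
have [] := @Rolle R f x y xy.
- by move=> z /sub/fdf[].
- apply: continuous_subspaceW cf => z /=; move: xab yab; rewrite !in_itv /=.
  by move=> /andP[ax xb] /andP[ay yb] /andP[xz zy]; rewrite (le_trans ax xz) (le_trans zy yb).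
- by rewrite fx0 fy0.
move=> c cxy fc; have cab := sub c cxy.
exists (c :: s'); split; first by rewrite /= ss'.
  move: cxy; rewrite in_itv /= => /andP[xc cy].
  by rewrite xc /=; case: s' ps' {ss' zs'} => //= z s' /andP[yz ->]; rewrite (lt_trans cy yz).
move=> z; rewrite inE => /predU1P[->|]; last exact: zs'.
split; first exact: subset_itv_oo_cc.
by move/@derive_val: fc; move/@derive_val: (fdf c cab) => ->.
Qed.

Lemma iterated_Rolle (R : realType) (a b : R) (n : nat) (F : nat -> R -> R)
    (x : R) (s : seq R) :
  (forall i, (i < n)%N -> {within `[a, b], continuous (F i)}) ->
  (forall i y, (i < n)%N -> y \in `]a, b[%R -> is_derive y 1 (F i) (F i.+1 y)) ->
  path <%R x s -> size s = n ->
  (forall y, y \in x :: s -> y \in `[a, b]%R /\ F 0%N y = 0) ->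
  exists2 c, c \in `[a, b]%R & F n c = 0.
Proof.
elim: n F x s => [|n IH] F x s cF dF pxs ns zs.
  by have [xab Fx] := zs x (mem_head _ _); exists x.
have [[|x' s'] [ss' ps' zs']] := Rolle_zeros (cF 0%N isT) (fun y => dF 0%N y isT) pxs zs.
  by move: ss'; rewrite ns.
apply: (IH (fun i => F i.+1) x' s') => //.
- by move=> i ni; exact: cF.
- by move=> i y ni; exact: dF.
- by move: ps' => /= /andP[].
- by move: ss'; rewrite ns => -[].
Qed.

Lemma derivn_size_le (R : nzRingType) (p : {poly R}) (n : nat) :
  (size p <= n.+1)%N -> p^`(n) = (p`_n *+ n`!)%:P.
Proof.
move=> sp; apply/polyP => -[|i]; rewrite coef_derivn coefC /=.
  by rewrite addn0 ffactnn.
by rewrite nth_default ?mul0rn// (leq_trans sp)// addnS ltnS leq_addr.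
Qed.

(** Fix t outside the nodes and let w be the product of the 'X - y over the nodes
y.  Choose c so that G 0 - q - c w vanishes at t as well: it then has n + 2
zeros, so its derivative of order n + 1, which is G (n + 1) - c (n + 1)!,
vanishes somewhere; this bounds c. *)
Lemma interpolation_error (R : realType) (a b : R) (n : nat) (G : nat -> R -> R)
    (q : {poly R}) (x : R) (s : seq R) (M t : R) :
  (forall i, (i <= n)%N -> {within `[a, b], continuous (G i)}) ->
  (forall i y, (i <= n)%N -> y \in `]a, b[%R -> is_derive y 1 (G i) (G i.+1 y)) ->
  path <%R x s -> size s = n -> {subset x :: s <= `[a, b]%R} ->
  (size q <= n.+1)%N -> (forall y, y \in x :: s -> q.[y] = G 0%N y) ->
  (forall y, y \in `[a, b]%R -> `|G n.+1 y| <= M) ->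
  t \in `[a, b]%R ->
  `|G 0%N t - q.[t]| <= M / n.+1`!%:R * \prod_(y <- x :: s) `|t - y|.
Proof.
move=> cG dG pxs ns sab sq qG GM tab.
have M0 : 0 <= M by apply: le_trans (GM t tab).
have [ts|tNs] := boolP (t \in x :: s).
  by rewrite -qG// subrr normr0 mulr_ge0 ?divr_ge0// prodr_ge0.
pose w : {poly R} := \prod_(y <- x :: s) ('X - y%:P).
have wt : w.[t] != 0 by rewrite -/(root w t) root_prod_XsubC.
pose c := (G 0%N t - q.[t]) / w.[t].
pose p := q + c *: w.
pose E i y := G i y - p^`(i).[y].
have us : uniq (t :: x :: s).
  by rewrite cons_uniq tNs (sorted_uniq (@lt_trans _ _) (@ltxx _ _)).
pose s' := sort <=%R (t :: x :: s).
have ps' : sorted <%R s' by rewrite sort_lt_sorted.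
have ss' : size s' = n.+2 by rewrite size_sort /= ns.
have zs' y : y \in s' -> y \in `[a, b]%R /\ E 0%N y = 0.
  rewrite mem_sort inE => /predU1P[->|ys]; split=> //.
  - by rewrite /E /= /p hornerD hornerZ /c divfK// [q.[t] + _]addrC subrK subrr.
  - exact: sab.
  - rewrite /E /= /p hornerD hornerZ qG//.
    have /eqP -> : root w y by rewrite root_prod_XsubC.
    by rewrite mulr0 addr0 subrr.
have [xi xiab Exi] : exists2 c, c \in `[a, b]%R & E n.+1 c = 0.
  case: s' ps' ss' zs' => // x' s' /= px' [ss'] zs'.
  apply: (@iterated_Rolle _ a b n.+1 E x' s') => //.
  - move=> i ni y; apply: cvgB; first exact: cG.
    by apply: continuous_subspaceT; exact: continuous_horner.
  - move=> i y ni yab; have := dG i y ni yab => h.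
    by rewrite /E derivnS; apply: is_deriveB.
have Gxi : G n.+1 xi = c * n.+1`!%:R.
  have sw : size w = n.+2 by rewrite /w size_prod_XsubC /= ns.
  have w1 : w`_n.+1 = 1.
    by have /monicP := monic_prod_XsubC (x :: s) predT id; rewrite /lead_coef sw.
  move: Exi; rewrite /E derivn_size_le; last first.
    by rewrite (leq_trans (size_polyD _ _))// geq_max (leqW sq) -sw size_scale_leq.
  rewrite hornerC /p coefD coefZ w1 mulr1 nth_default// add0r => /eqP.
  by rewrite subr_eq0 mulr_natr => /eqP.
rewrite -[_ - q.[t]](divfK wt) -/c normrM.
have -> : `|w.[t]| = \prod_(y <- x :: s) `|t - y|.
  rewrite /w horner_prod normr_prod; apply: eq_bigr => y _.
  by rewrite hornerXsubC.
rewrite ler_wpM2r ?prodr_ge0// ler_pdivlMr ?ltr0n ?fact_gt0//.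
by rewrite -[X in _ * X]ger0_norm// -normrM -Gxi GM.
Qed.

(** * Differentiation relative to a segment *)

Section derive_on.
Variables (R : realType) (a b : R).
Implicit Types (f : R -> R) (x : R).

Lemma within_dnbhs_interior x : x \in `]a, b[%R -> within `[a, b] x^' = x^'.
Proof.
move=> xab; apply/seteqP; split => P; last by apply: filterS => y Py _.
move=> FP; have FD : x^' `[a, b]%classic.
  suff h : nbhs x `[a, b]%classic by apply: filterS h => y yab _.
  near=> y; suff : y \in `]a, b[ by apply: subset_itv_oo_cc.
  by near: y; exact: near_in_itvoo.
have {}FP : x^' (fun y => `[a, b]%classic y -> P y) := FP.
by near=> y; have : `[a, b]%classic y; near: y.
Unshelve. all: by end_near. Qed.

Let near_neq x : \forall y \near x^', y != x.
Proof. by rewrite /dnbhs; exact: withinT. Qed.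

Lemma derive_on_interior f x l : x \in `]a, b[%R ->
  is_derive x 1 f l -> derive_on `[a, b] f x = l.
Proof.
move=> xab /is_derive1_caratheodory[g [fg cg gx]].
rewrite /derive_on within_dnbhs_interior//; apply: cvg_lim => //.
have := (continuous_withinNx _ _).1 cg; rewrite gx; apply: cvg_trans.
apply: near_eq_cvg; near=> y.
have yx : y != x by near: y; exact: near_neq.
by rewrite /diff_quot fg mulfK// subr_eq0.
Unshelve. all: by end_near. Qed.

Lemma derivable_on_is_derive f x : x \in `]a, b[%R ->
  derivable_on `[a, b] f x -> is_derive x 1 f (derive_on `[a, b] f x).
Proof.
move=> xab; rewrite /derivable_on /derive_on (within_dnbhs_interior xab) => cf.
apply/is_derive1_caratheodory.
exists (fun y => if y == x then lim (diff_quot f x y @[y --> x^']) else diff_quot f x y).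
split; last by rewrite eqxx.
- move=> z; have [->|zx] := eqVneq z x; first by rewrite !subrr mulr0.
  by rewrite /diff_quot divfK// subr_eq0.
- apply/continuous_withinNx; rewrite eqxx; apply: cvg_trans cf.
  apply: near_eq_cvg; near=> y.
  have yx : y != x by near: y; exact: near_neq.
  by rewrite (negbTE yx).
Unshelve. all: by end_near. Qed.

Lemma derivable_on_continuous f x : 
  derivable_on `[a, b] f x -> f y @[y --> within `[a, b] (nbhs x)] --> f x.
Proof.
move=> cf.
have h : diff_quot f x y * (y - x) @[y --> within `[a, b] x^'] --> derive_on `[a, b] f x * (x - x).
  apply: cvgM; first exact: cf.
  apply: cvg_within_filter; apply: cvg_within_filter; apply: cvgB; [exact: cvg_id|exact: cvg_cst].
apply/cvgrPdist_le => e e0.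
rewrite subrr mulr0 in h; move/cvgrPdist_le : h => /(_ e e0) h.
have {}h : \forall y \near x, y != x -> `[a, b]%classic y ->
  `|0 - diff_quot f x y * (y - x)| <= e := h.
suff : \forall y \near x, `[a, b]%classic y -> `|f x - f y| <= e by [].
near=> y => yab; have [->|yx] := eqVneq y x; first by rewrite subrr normr0 ltW.
have : `|0 - diff_quot f x y * (y - x)| <= e.
  by move: yx yab; near: y.
rewrite sub0r normrN /diff_quot divfK ?subr_eq0//.
by rewrite distrC.
Unshelve. all: by end_near. Qed.

(** This turns one-sided derivatives into what Rolle-type arguments use:
continuity on the closed segment and ordinary derivatives inside it. *)
Lemma Cn_on_chain n f : Cn_on `[a, b] n f ->
  (forall i, (i <= n)%N -> {within `[a, b], continuous (derive_onn `[a, b] i f)}) /\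
  (forall i x, (i < n)%N -> x \in `]a, b[%R ->
    is_derive x 1 (derive_onn `[a, b] i f) (derive_onn `[a, b] i.+1 f x)).
Proof.
move=> [df cf]; split=> [i|i x iin xab].
  rewrite leq_eqVlt => /predU1P[->//|iin].
  apply/subspace_continuousP => x xab; apply: derivable_on_continuous.
  exact: df.
apply: derivable_on_is_derive => //; apply: df => //.
exact: subset_itv_oo_cc.
Qed.

End derive_on.

(** Continuity is assumed on the larger segment only, since phi'' is the
derivative relative to [x_0, x_k] even when it is maximised over [x_0, x_1]. *)
Lemma le_max_on (R : realType) (a b c d : R) (g : R -> R) (t : R) :
  a <= c -> d <= b -> {within `[a, b], continuous g} -> t \in `[c, d] ->
  g t <= max_on c d g.
Proof.
move=> ac db cg tcd; have /andP[ct td] : c <= t <= d by move: tcd; rewrite in_itv.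
have ab : a <= b by lra.
have [m _ gm] := EVT_max ab cg.
apply: ub_le_sup; last by exists t.
exists (g m) => _ [s + <-]; rewrite /= in_itv /= => /andP[cs sd]; apply: gm.
by rewrite in_itv /= (le_trans ac cs) (le_trans sd db).
Qed.

(** * Integration by parts against the singular weight *)

Section weight.
Variable R : realType.
Local Notation mu := (@lebesgue_measure R).
Implicit Types (a b x t p alpha : R).

Lemma is_derive_powR_sub x p t : t < x ->
  is_derive t 1 (fun y => (x - y) `^ p) (- p * (x - t) `^ (p - 1)).
Proof.
move=> tx; have xt : 0 < x - t by rewrite subr_gt0.
have h1 := is_derive1_powR p xt.
have h2 : is_derive t 1 (fun y : R => x - y) (- 1).
  by apply: trigger_derive; rewrite add0r mul1r.
rewrite (_ : - p * _ = p * (x - t) `^ (p - 1) * - 1); last by ring.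
exact: (@is_derive1_comp R (fun y => y `^ p) (fun y => x - y) t _ _ h1 h2).
Qed.

Lemma powRN_le (u v : R) alpha : 0 <= alpha -> 0 < u -> u <= v ->
  v `^ (- alpha) <= u `^ (- alpha).
Proof.
move=> al0 u0 uv; have v0 := lt_le_trans u0 uv.
rewrite !powRN lef_pV2 ?posrE ?powR_gt0//.
by apply: ge0_ler_powR => //; rewrite nnegrE ltW.
Qed.

Lemma cvg_powR_sub b p : 0 < p -> (b - t) `^ p @[t --> b^'-] --> 0.
Proof.
move=> p0; apply/cvg_at_leftP => s [sb cs].
apply: ((cvg_at_rightP (fun y => y `^ p) _ _).1 (powR_cvg0 p0)).
split=> [n|]; first by rewrite subr_gt0.
by rewrite -(subrr b); apply: cvgB => //; exact: cvg_cst.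
Qed.

Lemma within_continuous_powR_sub a b p : a < b -> 0 < p ->
  {within `[a, b], continuous (fun t => (b - t) `^ p)}.
Proof.
move=> ab p0; have cw t : t < b -> {for t, continuous (fun t => (b - t) `^ p)}.
  by move=> tb; exact: is_derive_continuous (is_derive_powR_sub _ tb).
apply/continuous_within_itvP => //; split.
- by move=> t; rewrite in_itv /= => /andP[_ tb]; exact: cw.
- by apply: cvg_at_right_filter; exact: cw.
- by rewrite subrr powR0 ?gt_eqF//; exact: cvg_powR_sub.
Qed.

Lemma integrable_powR_sub a b alpha : alpha < 1 -> a < b ->
  mu.-integrable `]a, b[ (EFin \o (fun t => (b - t) `^ (- alpha))).
Proof.
move=> al1 ab.
pose v (n : nat) : R := b - (b - a) / n.+2%:R.
have vb n : v n < b by rewrite /v ltrBlDr ltrDl divr_gt0 ?subr_gt0 ?ltr0n.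
have uv n : a <= v n.
  rewrite /v lerBrDl -lerBrDr ler_pdivrMr ?ltr0n// ler_peMr ?subr_ge0 ?(ltW ab)//.
  by rewrite ler1n.
have v_ndecr n : v n <= v n.+1.
  rewrite /v lerD2l lerN2 ler_wpM2l ?subr_ge0 ?(ltW ab)//.
  by rewrite lef_pV2 ?posrE ?ltr0n// ler_nat.
have Dv : `[a, b[%classic = \bigcup_n `[a, v n]%classic.
  apply/seteqP; split => [t|t [n _]] /=; rewrite !in_itv /=; last first.
    by move=> /andP[-> tv]; rewrite (le_lt_trans tv).
  move=> /andP[at_ tb]; exists (Num.truncn ((b - a) / (b - t))) => //=.
  rewrite in_itv /= at_ /v /= lerBrDr -lerBrDl.
  rewrite ler_pdivrMr ?ltr0n// mulrC -ler_pdivrMr ?subr_gt0//.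
  by rewrite (le_trans (ltW (truncnS_gt _)))// ler_nat.
suff : mu.-integrable `[a, b[ (EFin \o (fun t => (b - t) `^ (- alpha))).
  by apply: integrableS => //; apply: subset_itvr; rewrite bnd_simp.
have D0 t : `[a, b[%classic t -> t < b by rewrite /= in_itv /= => /andP[].
have al0 : 0 < 1 - alpha by rewrite subr_gt0.
apply: (integrable_exhaustion uv (fun=> lexx a) v_ndecr Dv _
  (F := fun t => - (1 - alpha)^-1 * (b - t) `^ (1 - alpha))
  (dF := fun t => (b - t) `^ (- alpha)) (C := (1 - alpha)^-1 * (b - a) `^ (1 - alpha))).
- by move=> t /D0 tb; exact: is_derive_continuous (is_derive_powR_sub _ tb).
- move=> t /D0 tb; have h := is_derive_powR_sub (1 - alpha) tb.
  apply: trigger_derive; rewrite /GRing.scale /= (_ : 1 - alpha - 1 = - alpha); last ring.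
  by field; rewrite gt_eqF.
- by move=> t _; rewrite ger0_norm ?powR_ge0.
- move=> n; rewrite !mulNr opprK addrC lerBlDr lerDl.
  by rewrite mulr_ge0 ?powR_ge0// invr_ge0 ltW.
Qed.

Lemma Rintegral_eq_oo a b (f h : R -> R) : measurable_fun `]a, b[ h ->
  {in `]a, b[, f =1 h} ->
  \int[mu]_(t in `[a, b]) f t = \int[mu]_(t in `[a, b]) h t.
Proof.
move=> mh fh; rewrite /Rintegral; congr fine; apply: eq_integral_itv_bounded => //.
apply: eq_measurable_fun mh => t; rewrite inE => tab; exact/esym/fh.
Qed.

(** With w(t) = (x - t)^(-alpha), the primitive F = w E of w E' + w' E vanishes at
a and b, so the comparison principle bounds the integral of w E' by any
G(b) - G(a) with |w' E| <= G'.  For x = b the bound |E(t)| <= C (b - t) makes F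
continuous at b, as |F(t)| <= C (b - t)^(1-alpha).  The integrand f is prescribed
only inside, where derivatives relative to the cell are ordinary ones. *)
Lemma Rintegral_weight_le a b x alpha (E dE G dG f : R -> R) (L C : R) :
  0 < alpha < 1 -> a < b -> b <= x ->
  {within `[a, b], continuous E} ->
  (forall t, t \in `]a, b[ -> is_derive t 1 E (dE t)) ->
  (forall t, t \in `]a, b[ -> {for t, continuous dE}) ->
  (forall t, t \in `]a, b[ -> `|dE t| <= L) ->
  E a = 0 ->
  (forall t, t \in `[a, b] -> `|E t| <= C * (b - t)) ->
  {within `[a, b], continuous G} ->
  (forall t, t \in `]a, b[ -> is_derive t 1 G (dG t)) ->
  (forall t, t \in `]a, b[ -> alpha * (x - t) `^ (- alpha - 1) * `|E t| <= dG t) ->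
  (forall t, t \in `]a, b[ -> f t = (x - t) `^ (- alpha) * dE t) ->
  `|\int[mu]_(t in `[a, b]) f t| <= G b - G a.
Proof.
move=> /andP[al0 al1] ab bx cE dEE cdE dEL Ea EC cG dGE GE fE.
have oo t : t \in `]a, b[ -> a < t /\ t < b by rewrite in_itv /= => /andP[].
pose w t := (x - t) `^ (- alpha).
pose dw t := alpha * (x - t) `^ (- alpha - 1).
have dwE t : t < b -> is_derive t 1 w (dw t).
  move=> tb; rewrite /dw -[X in X * _]opprK.
  exact: is_derive_powR_sub (lt_le_trans tb bx).
have cw t : t < b -> {for t, continuous w}.
  by move=> tb; exact: is_derive_continuous (dwE t tb).
have ch t : t \in `]a, b[ -> {for t, continuous (fun y => w y * dE y)}.
  by move=> tab; have [_ tb] := oo t tab; apply: cvgM; [exact: cw|exact: cdE].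
have mh : measurable_fun `]a, b[ (fun y => w y * dE y).
  apply: open_continuous_measurable_fun => // t; rewrite inE => tab; exact: ch.
(* Cutting w E' off at the end points gives a function that is integrable on the
   closed segment by domination on the open one. *)
pose h := (fun y => w y * dE y) \_ `]a, b[.
have hE : {in `]a, b[, forall t, h t = w t * dE t}.
  by move=> t tab; rewrite /h patchE mem_set.
have L0 : 0 <= L.
  have mab : (a + b) / 2 \in `]a, b[ by apply: mid_in_itvoo.
  exact: le_trans (dEL _ mab).
have ih : mu.-integrable `[a, b] (EFin \o h).
  rewrite /h -restrict_EFin; apply/integrable_restrict => //.
  rewrite setIidr; last exact: subset_itv_oo_cc.
  have : mu.-integrable `]a, b[ (fun t => L%:E * ((b - t) `^ (- alpha))%:E)%E.
    by apply: integrableZl => //; exact: integrable_powR_sub.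
  apply: le_integrable => //; first exact/measurable_EFinP.
  move=> t tab; have [_ tb] := oo t tab.
  rewrite /= lee_fin normrM [leRHS]ger0_norm ?mulr_ge0 ?powR_ge0//.
  rewrite mulrC ler_pM ?normr_ge0 ?dEL// ger0_norm ?powR_ge0//.
  by apply: powRN_le; rewrite ?subr_gt0 ?lerD2r// ltW.
rewrite (@Rintegral_eq_oo a b f h); last 2 first.
- apply: eq_measurable_fun mh => t; rewrite inE => tab; exact/esym/hE.
- by move=> t tab; rewrite hE// fE.
have chh t : t \in `]a, b[ -> {for t, continuous h}.
  move=> tab; have := ch t tab; rewrite /prop_for /continuous_at hE//.
  apply: cvg_trans; apply: near_eq_cvg; near=> y; rewrite hE//.
  by near: y; exact: near_in_itvoo.
pose F t := w t * E t.
have Eb : E b = 0.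
  apply/eqP; rewrite -normr_le0; have := EC b; rewrite subrr mulr0; apply.
  by rewrite in_itv /= lexx ltW.
have [cEo cEa cEb] := (continuous_within_itvP E ab).1 cE.
have cF : {within `[a, b], continuous F}.
  apply/continuous_within_itvP => //; split.
  - by move=> t tab; have [_ tb] := oo t tab; apply: cvgM; [exact: cw|exact: cEo].
  - by apply: cvgM => //; apply: cvg_at_right_filter; exact: cw.
  - rewrite /F Eb mulr0.
    have lim0 : C * (b - t) `^ (1 - alpha) @[t --> b^'-] --> (0 : R).
      rewrite -[X in _ --> X](mulr0 C); apply: cvgM; first exact: cvg_cst.
      by apply: cvg_powR_sub; rewrite subr_gt0.
    apply/norm_cvg0P; apply: (squeeze_cvgr _ (cvg_cst 0) lim0).
    near=> t.
    have tb : t < b by near: t; exact: nbhs_left_lt.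
    have ta : a < t by near: t; exact: nbhs_left_gt.
    rewrite normr_ge0 normrM ger0_norm ?powR_ge0//=.
    apply: (@le_trans _ _ ((b - t) `^ (- alpha) * (C * (b - t)))).
      apply: ler_pM; rewrite ?powR_ge0 ?normr_ge0//.
        by apply: powRN_le; rewrite ?subr_gt0 ?lerD2r// ltW.
      by apply: EC; rewrite in_itv /= !ltW.
    have bt : 0 < b - t by rewrite subr_gt0.
    rewrite -(@mulr_powRB1 _ (b - t) (1 - alpha)) ?subr_gt0 ?(ltW bt)//.
    rewrite (_ : 1 - alpha - 1 = - alpha); last by ring.
    by rewrite mulrC -mulrA.
have -> : \int[mu]_(t in `[a, b]) h t = \int[mu]_(t in `[a, b]) h t - (F b - F a).
  by rewrite /F Ea Eb !mulr0 subrr subr0.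
apply: (@Rintegral_dist_primitive _ _ _ (fun t => dw t * E t + w t * dE t) _ dG) => //.
- exact: ltW.
- move=> t tab; have [_ tb] := oo t tab.
  have h1 := dwE t tb; have h2 := dEE t tab.
  apply: trigger_derive; rewrite /GRing.scale /=; ring.
- move=> t tab; rewrite hE// opprD addrCA subrr addr0 normrN normrM ger0_norm.
    exact: GE.
  by rewrite mulr_ge0 ?powR_ge0 ?ltW.
Unshelve. all: by end_near. Qed.

End weight.

(** * The two interpolants *)

Section interpolants.
Variables (R : realType) (h : R) (phi : R -> R).
Hypothesis h0 : 0 < h.

Lemma nodeS j : node h j.+1 = node h j + h.
Proof. by rewrite /node -natr1 mulrDl mul1r. Qed.

Lemma node_le i j : (i <= j)%N -> node h i <= node h j.
Proof. by move=> ij; rewrite ler_wpM2r ?ler_nat// ltW. Qed.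

Lemma lin_interp_poly j : exists q : {poly R},
  (size q <= 2)%N /\ lin_interp h phi j =1 horner q.
Proof.
set A := phi (node h j); set B := phi (node h j.+1).
exists (Poly [:: (node h j.+1 * A - node h j * B) / h; (B - A) / h]).
split; first exact: size_Poly.
move=> t; rewrite horner_Poly /= /lin_interp -/A -/B; field.
by rewrite gt_eqF.
Qed.

Lemma quad_interp_poly j : exists q : {poly R},
  (size q <= 3)%N /\ quad_interp h phi j =1 horner q.
Proof.
rewrite /quad_interp; set A := phi (node h (j - 2)); set B := phi (node h (j - 1)).
set C := phi (node h j); set u := node h (j - 2); set v := node h (j - 1); set w := node h j.
exists (Poly [:: (v * w * A - 2 * u * w * B + u * v * C) / (2 * h ^+ 2);
                 (- (v + w) * A + 2 * (u + w) * B - (u + v) * C) / (2 * h ^+ 2);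
                 (A - 2 * B + C) / (2 * h ^+ 2)]).
split; first exact: size_Poly.
by move=> t; rewrite horner_Poly /=; field; rewrite gt_eqF.
Qed.

Lemma lin_interp_node j :
  (lin_interp h phi j (node h j) = phi (node h j)) *
  (lin_interp h phi j (node h j.+1) = phi (node h j.+1)).
Proof.
rewrite /lin_interp nodeS; split; field; by rewrite gt_eqF.
Qed.

Lemma quad_interp_node j :
  [/\ quad_interp h phi j.+2 (node h j) = phi (node h j),
      quad_interp h phi j.+2 (node h j.+1) = phi (node h j.+1) &
      quad_interp h phi j.+2 (node h j.+2) = phi (node h j.+2)].
Proof.
rewrite /quad_interp !subSS !subn0 !nodeS; split; field; by rewrite gt_eqF.
Qed.

Variables (a b : R) (G : nat -> R -> R).
Hypothesis G0 : G 0%N = phi.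

Lemma lin_interp_error j (M t : R) :
  a <= node h j -> node h j.+1 <= b ->
  (forall i, (i <= 1)%N -> {within `[a, b], continuous (G i)}) ->
  (forall i y, (i <= 1)%N -> y \in `]a, b[ -> is_derive y 1 (G i) (G i.+1 y)) ->
  (forall y, y \in `[node h j, node h j.+1] -> `|G 2 y| <= M) ->
  t \in `[node h j, node h j.+1] ->
  `|phi t - lin_interp h phi j t| <= M / 2 * ((t - node h j) * (node h j.+1 - t)).
Proof.
move=> aj jb cG dG GM tj; have [q [sq qE]] := lin_interp_poly j.
have jj : node h j < node h j.+1 by rewrite nodeS ltrDl.
have [t1 t2] : node h j <= t /\ t <= node h j.+1 by move: tj; rewrite in_itv => /andP.
have cG' i : (i <= 1)%N -> {within `[node h j, node h j.+1], continuous (G i)}.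
  move=> i1; apply: continuous_subspaceW (cG i i1); apply: subset_itv; by rewrite bnd_simp.
have dG' i y : (i <= 1)%N -> y \in `]node h j, node h j.+1[ ->
    is_derive y 1 (G i) (G i.+1 y).
  move=> i1 yj; apply: dG i1 _; move: yj; rewrite !in_itv /= => /andP[y1 y2].
  by rewrite (le_lt_trans aj y1) (lt_le_trans y2 jb).
have pj : path <%R (node h j) [:: node h j.+1] by rewrite /= jj.
have sj : {subset [:: node h j; node h j.+1] <= `[node h j, node h j.+1]%R}.
  by move=> y; rewrite in_cons mem_seq1 => /orP[] /eqP ->; rewrite in_itv /= lexx ltW.
have qG y : y \in [:: node h j; node h j.+1] -> q.[y] = G 0%N y.
  by rewrite G0 !inE -qE => /orP[] /eqP ->; rewrite lin_interp_node.
have := interpolation_error cG' dG' pj erefl sj sq qG GM tj.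
rewrite G0 qE !big_cons big_nil mulr1 (_ : 2`! = 2)%N; last by [].
rewrite [`|t - node h j|]ger0_norm ?subr_ge0// [`|t - node h j.+1|]distrC.
by rewrite [`|_ - t|]ger0_norm ?subr_ge0.
Qed.

Lemma quad_interp_error j (M t : R) :
  a <= node h j -> node h j.+2 <= b ->
  (forall i, (i <= 2)%N -> {within `[a, b], continuous (G i)}) ->
  (forall i y, (i <= 2)%N -> y \in `]a, b[ -> is_derive y 1 (G i) (G i.+1 y)) ->
  (forall y, y \in `[a, b] -> `|G 3 y| <= M) ->
  t \in `[node h j.+1, node h j.+2] ->
  `|phi t - quad_interp h phi j.+2 t| <=
    M / 6 * ((t - node h j) * (t - node h j.+1) * (node h j.+2 - t)).
Proof.
move=> aj jb cG dG GM tj; have [q [sq qE]] := quad_interp_poly j.+2.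
have j01 : node h j < node h j.+1 by rewrite nodeS ltrDl.
have j12 : node h j.+1 < node h j.+2 by rewrite [node h j.+2]nodeS ltrDl.
have [t1 t2] : node h j.+1 <= t /\ t <= node h j.+2 by move: tj; rewrite in_itv => /andP.
have cG' i : (i <= 2)%N -> {within `[node h j, node h j.+2], continuous (G i)}.
  move=> i1; apply: continuous_subspaceW (cG i i1); apply: subset_itv; by rewrite bnd_simp.
have dG' i y : (i <= 2)%N -> y \in `]node h j, node h j.+2[ ->
    is_derive y 1 (G i) (G i.+1 y).
  move=> i1 yj; apply: dG i1 _; move: yj; rewrite !in_itv /= => /andP[y1 y2].
  by rewrite (le_lt_trans aj y1) (lt_le_trans y2 jb).
have pj : path <%R (node h j) [:: node h j.+1; node h j.+2] by rewrite /= j01 j12.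
have sj : {subset [:: node h j; node h j.+1; node h j.+2] <= `[node h j, node h j.+2]%R}.
  by move=> y; rewrite !in_cons orbF => /or3P[] /eqP ->; rewrite in_itv /=; lra.
have qG y : y \in [:: node h j; node h j.+1; node h j.+2] -> q.[y] = G 0%N y.
  have [e0 e1 e2] := quad_interp_node j.
  by rewrite G0 !inE -qE => /or3P[] /eqP ->.
have GM' y : y \in `[node h j, node h j.+2] -> `|G 3 y| <= M.
  rewrite in_itv /= => /andP[y1 y2]; apply: GM.
  by rewrite in_itv /= (le_trans aj y1) (le_trans y2 jb).
have tj' : t \in `[node h j, node h j.+2] by rewrite in_itv /=; lra.
have := interpolation_error cG' dG' pj erefl sj sq qG GM' tj'.
rewrite G0 qE !big_cons big_nil mulr1 (_ : 3`! = 6)%N; last by [].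
have t0 : 0 <= t - node h j by lra.
rewrite (ger0_norm t0) [`|t - node h j.+1|]ger0_norm ?subr_ge0// [`|t - node h j.+2|]distrC.
by rewrite [`|_ - t|]ger0_norm ?subr_ge0// !mulrA.
Qed.

End interpolants.

(** * The Caputo term on one cell *)

Section caputo.
Variables (R : realType) (alpha : R).
Hypothesis al01 : 0 < alpha < 1.
Local Notation mu := (@lebesgue_measure R).
Variables (a b x : R) (phi dphi p : R -> R) (q : {poly R}).
Hypotheses (ab : a < b) (bx : b <= x).
Hypothesis cphi : {within `[a, b], continuous phi}.
Hypothesis cdphi : {within `[a, b], continuous dphi}.
Hypothesis dphiE : forall t, t \in `]a, b[ -> is_derive t 1 phi (dphi t).
Hypothesis pE : p =1 horner q.
Hypothesis pa : phi a = p a.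

Let al0 : 0 < alpha. Proof. by have /andP[] := al01. Qed.
Let al1 : alpha < 1. Proof. by have /andP[] := al01. Qed.

Local Notation I := (\int[mu]_(t in `[a, b])
  ((x - t) `^ (- alpha) * derive_on `[a, b] (phi \- p) t)).

(** The interpolant enters only as a polynomial q agreeing with phi at the left
node; agreement at the right node follows from the bound by C (b - t). *)
Lemma caputo_error_le (C : R) (G dG : R -> R) :
  (forall t, t \in `[a, b] -> `|phi t - p t| <= C * (b - t)) ->
  {within `[a, b], continuous G} ->
  (forall t, t \in `]a, b[ -> is_derive t 1 G (dG t)) ->
  (forall t, t \in `]a, b[ ->
    alpha * (x - t) `^ (- alpha - 1) * `|phi t - p t| <= dG t) ->
  `|I| <= G b - G a.
Proof.
move=> EC cG dGE GE.
have -> : p = horner q by apply/funext => t; exact: pE.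
have dE t : t \in `]a, b[ -> is_derive t 1 (phi \- horner q) (dphi t - q^`().[t]).
  by move=> tab; have h := dphiE tab; exact: is_deriveB.
have cdE : {within `[a, b], continuous (fun t => dphi t - q^`().[t])}.
  move=> t; apply: cvgB; first exact: cdphi.
  by apply: continuous_subspaceT; exact: continuous_horner.
have [m _ mL] := EVT_max (ltW ab) (fun t => cvg_norm (cdE t)).
have [cdEo _ _] := (continuous_within_itvP _ ab).1 cdE.
apply: (@Rintegral_weight_le _ a b x alpha (phi \- horner q)
  (fun t => dphi t - q^`().[t]) G dG _ (`|dphi m - q^`().[m]|) C) => //.
- move=> t; apply: cvgB; first exact: cphi.
  by apply: continuous_subspaceT; exact: continuous_horner.
- by move=> t tab; apply: mL; exact: subset_itv_oo_cc.
- by rewrite /= pa pE subrr.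
- by move=> t tab; rewrite /= -pE EC.
- by move=> t tab; rewrite /= -pE GE.
- by move=> t tab; rewrite (derive_on_interior tab (dE t tab)).
Qed.

Let in_oo t : t \in `]a, b[ -> a < t /\ t < b.
Proof. by rewrite in_itv /= => /andP[]. Qed.

Let oo_cc t : t \in `]a, b[ -> t \in `[a, b].
Proof. by move=> tab; exact: subset_itv_oo_cc. Qed.

Lemma caputo_error_lin_away (M : R) : 0 <= M -> b < x ->
  (forall t, t \in `[a, b] -> `|phi t - p t| <= M / 2 * ((t - a) * (b - t))) ->
  `|I| <= alpha / 12 * M * (x - b) `^ (- alpha - 1) * (b - a) ^+ 3.
Proof.
move=> M0 bx' E; pose c := alpha * (x - b) `^ (- alpha - 1) * (M / 2).
pose G t := c * ((b - a) * (t - a) ^+ 2 / 2 - (t - a) ^+ 3 / 3).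
have dG (t : R) : is_derive t 1 G (c * ((t - a) * (b - t))).
  by apply: trigger_derive; rewrite /GRing.scale /=; field.
have -> : alpha / 12 * M * (x - b) `^ (- alpha - 1) * (b - a) ^+ 3 = G b - G a.
  by rewrite /G /c; field.
apply: (@caputo_error_le (M / 2 * (b - a)) _ (fun t => c * ((t - a) * (b - t)))) => //.
- move=> t tab; apply: le_trans (E t tab) _; rewrite -[leRHS]mulrA.
  move: tab; rewrite in_itv /= => /andP[t1 t2].
  by apply: ler_wpM2l; [lra | apply: ler_wpM2r; lra].
- by apply: continuous_subspaceT => t; exact: is_derive_continuous (dG t).
- move=> t tab; have [t1 t2] := in_oo tab.
  rewrite /c -[leRHS]mulrA; apply: ler_pM; rewrite ?normr_ge0 ?mulr_ge0 ?powR_ge0 ?(ltW al0)//.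
    rewrite ler_pM2l// (_ : - alpha - 1 = - (alpha + 1)); last by ring.
    by apply: powRN_le; move: al0; lra.
  exact: E (oo_cc tab).
Qed.

(** The weight alpha (x - t)^(-alpha-1) is the derivative of (x - t)^(-alpha), so
a constant bound on the error gives an increment that telescopes over the cells.
The bound by C (b - t) only records that the error vanishes at b. *)
Lemma caputo_error_mid (M : R) : b < x ->
  (forall t, t \in `[a, b] -> `|phi t - p t| <= M) ->
  (exists C, forall t, t \in `[a, b] -> `|phi t - p t| <= C * (b - t)) ->
  `|I| <= M * ((x - b) `^ (- alpha) - (x - a) `^ (- alpha)).
Proof.
move=> bx' E [C EC]; rewrite mulrBr.
have dG (t : R) : t < x -> is_derive t 1 (fun t => M * (x - t) `^ (- alpha))
    (M * (- - alpha * (x - t) `^ (- alpha - 1))).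
  by move=> tx; have h := is_derive_powR_sub (- alpha) tx; apply: trigger_derive.
apply: (@caputo_error_le C (fun t => M * (x - t) `^ (- alpha))
  (fun t => M * (- - alpha * (x - t) `^ (- alpha - 1)))) => //.
- apply: continuous_in_subspaceT => t; rewrite inE /= in_itv /= => /andP[_ tb].
  exact: is_derive_continuous (dG t (le_lt_trans tb bx')).
- by move=> t tab; have [t1 t2] := in_oo tab; apply: dG; lra.
- move=> t tab; rewrite opprK [leRHS]mulrC ler_wpM2l ?E ?oo_cc//.
  by rewrite mulr_ge0 ?powR_ge0// ltW.
Qed.

End caputo.

(** Stated for abstract functions so that the search for a derivative does not
unfold the powers to which it is applied. *)
Lemma is_derive_lincomb (R : realType) (f1 f2 f3 : R -> R) (c c1 c2 t d1 d2 d3 : R) :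
  is_derive t 1 f1 d1 -> is_derive t 1 f2 d2 -> is_derive t 1 f3 d3 ->
  is_derive t 1 (fun y => c * (c1 * f1 y - c2 * f2 y + f3 y))
    (c * (c1 * d1 - c2 * d2 + d3)).
Proof. by move=> h1 h2 h3; apply: trigger_derive. Qed.

Section singular.
Variables (R : realType) (alpha : R).
Hypothesis al01 : 0 < alpha < 1.
Local Notation mu := (@lebesgue_measure R).
Variables (a b : R) (phi dphi p : R -> R) (q : {poly R}).
Hypothesis ab : a < b.
Hypothesis cphi : {within `[a, b], continuous phi}.
Hypothesis cdphi : {within `[a, b], continuous dphi}.
Hypothesis dphiE : forall t, t \in `]a, b[ -> is_derive t 1 phi (dphi t).
Hypothesis pE : p =1 horner q.
Hypothesis pa : phi a = p a.

Let al0 : 0 < alpha. Proof. by have /andP[] := al01. Qed.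
Let al1 : alpha < 1. Proof. by have /andP[] := al01. Qed.

Local Notation I := (\int[mu]_(t in `[a, b])
  ((b - t) `^ (- alpha) * derive_on `[a, b] (phi \- p) t)).

(* The primitive of (b - t)^(r-1) that vanishes at b. *)
Let P (r t : R) : R := - ((b - t) `^ r / r).

Let dP (r t : R) : 0 < r -> t < b -> is_derive t 1 (P r) ((b - t) `^ (r - 1)).
Proof.
move=> r0 tb; have d := is_derive_powR_sub r tb.
by apply: trigger_derive; rewrite /GRing.scale /=; field; rewrite gt_eqF.
Qed.

Let cP (r : R) : 0 < r -> {within `[a, b], continuous (P r)}.
Proof.
move=> r0 t; apply: cvgN; apply: cvgM; last exact: cvg_cst.
exact: within_continuous_powR_sub ab r0 t.
Qed.

Let Pb (r : R) : 0 < r -> P r b = 0.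
Proof. by move=> r0; rewrite /P subrr powR0 ?gt_eqF// mul0r oppr0. Qed.

Let step (s r : R) : 0 < s -> s `^ r = s * s `^ (r - 1).
Proof.
move=> s0; rewrite powRB; last by apply/implyP => _; rewrite gt_eqF.
by rewrite powRr1 ?(ltW s0)// mulrCA divff ?mulr1// gt_eqF.
Qed.

Let ba0 : 0 < b - a. Proof. by rewrite subr_gt0. Qed.

(** With s = b - t and l = b - a, the majorant is alpha M/2 (l s^(-alpha) -
s^(1-alpha)). *)
Lemma caputo_error_lin_at (M : R) : 0 <= M ->
  (forall t, t \in `[a, b] -> `|phi t - p t| <= M / 2 * ((t - a) * (b - t))) ->
  `|I| <= alpha / (2 * ((1 - alpha) * (2 - alpha))) * M * (b - a) `^ (2 - alpha).
Proof.
move=> M0 E; pose c := alpha * (M / 2).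
pose G t := c * ((b - a) * P (1 - alpha) t - P (2 - alpha) t).
pose dG t := c * ((b - a) * (b - t) `^ (1 - alpha - 1) - (b - t) `^ (2 - alpha - 1)).
have r1 : 0 < 1 - alpha by have := al1; lra.
have r2 : 0 < 2 - alpha by have := al1; lra.
have -> : alpha / (2 * ((1 - alpha) * (2 - alpha))) * M * (b - a) `^ (2 - alpha) =
    G b - G a.
  rewrite /G /c !Pb// /P (step (2 - alpha) ba0) (_ : 2 - alpha - 1 = 1 - alpha); last by ring.
  by field; rewrite !gt_eqF.
apply: (caputo_error_le al01 ab (lexx b) cphi cdphi dphiE pE pa
  (C := M / 2 * (b - a)) (dG := dG)).
- move=> t tab; apply: le_trans (E t tab) _; rewrite -[leRHS]mulrA.
  move: tab; rewrite in_itv /= => /andP[t1 t2].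
  by apply: ler_wpM2l; [lra | apply: ler_wpM2r; lra].
- move=> t; apply: cvgM; first exact: cvg_cst.
  by apply: cvgB; [apply: cvgM; [exact: cvg_cst | exact: cP] | exact: cP].
- move=> t; rewrite in_itv /= => /andP[ta tb].
  by have d1 := dP r1 tb; have d2 := dP r2 tb; apply: trigger_derive.
- move=> t tab; have := tab; rewrite in_itv /= => /andP[ta tb].
  have bt : 0 < b - t by rewrite subr_gt0.
  have -> : dG t = alpha * (b - t) `^ (- alpha - 1) * (M / 2 * ((t - a) * (b - t))).
    rewrite /dG (_ : 1 - alpha - 1 = - alpha); last by ring.
    rewrite (_ : 2 - alpha - 1 = 1 - alpha); last by ring.
    rewrite (step (1 - alpha) bt) (_ : 1 - alpha - 1 = - alpha); last by ring.
    by rewrite (step (- alpha) bt) /c; ring.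
  apply: ler_wpM2l; first by rewrite mulr_ge0 ?powR_ge0 ?(ltW al0).
  by apply: E; exact: subset_itv_oo_cc.
Qed.

(** The left outer node of the quadratic interpolant is a - (b - a).  With
s = b - t and l = b - a, the majorant is
alpha M/6 (2 l^2 s^(-alpha) - 3 l s^(1-alpha) + s^(2-alpha)). *)
Lemma caputo_error_quad_at (M : R) : 0 <= M ->
  (forall t, t \in `[a, b] ->
    `|phi t - p t| <= M / 6 * ((t - (a - (b - a))) * (t - a) * (b - t))) ->
  `|I| <= alpha / (3 * (1 - alpha) * (2 - alpha)) * (1 / 2 + 1 / (3 - alpha)) *
    M * (b - a) `^ (3 - alpha).
Proof.
move=> M0 E; pose c := alpha * (M / 6).
pose G t := c * (2 * (b - a) ^+ 2 * P (1 - alpha) t -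
  3 * (b - a) * P (2 - alpha) t + P (3 - alpha) t).
pose dG t := c * (2 * (b - a) ^+ 2 * (b - t) `^ (1 - alpha - 1) -
  3 * (b - a) * (b - t) `^ (2 - alpha - 1) + (b - t) `^ (3 - alpha - 1)).
have r1 : 0 < 1 - alpha by have := al1; lra.
have r2 : 0 < 2 - alpha by have := al1; lra.
have r3 : 0 < 3 - alpha by have := al1; lra.
have -> : alpha / (3 * (1 - alpha) * (2 - alpha)) * (1 / 2 + 1 / (3 - alpha)) *
    M * (b - a) `^ (3 - alpha) = G b - G a.
  rewrite /G /c !Pb// /P (step (3 - alpha) ba0) (_ : 3 - alpha - 1 = 2 - alpha); last by ring.
  rewrite (step (2 - alpha) ba0) (_ : 2 - alpha - 1 = 1 - alpha); last by ring.
  by field; rewrite !gt_eqF.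
apply: (caputo_error_le al01 ab (lexx b) cphi cdphi dphiE pE pa
  (C := M / 6 * (2 * (b - a) ^+ 2)) (dG := dG)).
- move=> t tab; apply: le_trans (E t tab) _; rewrite -[leRHS]mulrA.
  move: tab; rewrite in_itv /= => /andP[t1 t2].
  apply: ler_wpM2l; first lra.
  by apply: ler_wpM2r; [lra | rewrite expr2 mulrA; apply: ler_pM; lra].
- move=> t; apply: cvgM; first exact: cvg_cst.
  apply: cvgD; last exact: cP.
  by apply: cvgB; apply: cvgM; first [exact: cvg_cst | exact: cP].
- move=> t; rewrite in_itv /= => /andP[ta tb].
  exact: is_derive_lincomb (dP r1 tb) (dP r2 tb) (dP r3 tb).
- move=> t tab; have := tab; rewrite in_itv /= => /andP[ta tb].
  have bt : 0 < b - t by rewrite subr_gt0.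
  have -> : dG t = alpha * (b - t) `^ (- alpha - 1) *
      (M / 6 * ((t - (a - (b - a))) * (t - a) * (b - t))).
    rewrite /dG (_ : 1 - alpha - 1 = - alpha); last by ring.
    rewrite (_ : 2 - alpha - 1 = 1 - alpha); last by ring.
    rewrite (_ : 3 - alpha - 1 = 2 - alpha); last by ring.
    rewrite (step (2 - alpha) bt) (_ : 2 - alpha - 1 = 1 - alpha); last by ring.
    rewrite (step (1 - alpha) bt) (_ : 1 - alpha - 1 = - alpha); last by ring.
    by rewrite (step (- alpha) bt) /c; ring.
  apply: ler_wpM2l; first by rewrite mulr_ge0 ?powR_ge0 ?(ltW al0).
  by apply: E; exact: subset_itv_oo_cc.
Qed.

End singular.

(** * The terms of the scheme error *)

Lemma Rintegral_bounded_le (R : realType) (a b B : R) (f : R -> R) :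
  a < b -> {within `[a, b], continuous f} ->
  (forall t, t \in `[a, b] -> `|f t| <= B) ->
  `|\int[lebesgue_measure]_(t in `[a, b]) f t| <= B * (b - a).
Proof.
move=> ab cf fB; have [cfo _ _] := (continuous_within_itvP f ab).1 cf.
have dG (t : R) : is_derive t 1 (fun y : R => B * y) B.
  by apply: trigger_derive; rewrite /GRing.scale /= mulr1.
have -> : \int[lebesgue_measure]_(t in `[a, b]) f t =
    \int[lebesgue_measure]_(t in `[a, b]) f t - (cst 0 b - cst 0 a).
  by rewrite subrr subr0.
rewrite mulrBr.
apply: (@Rintegral_dist_primitive R f (cst 0) (cst 0) (fun y => B * y) (cst B)).
- exact: ltW.
- by apply: continuous_compact_integrable => //; exact: segment_compact.
- exact: cfo.
- by apply: continuous_subspaceT; exact: cst_continuous.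
- by apply: continuous_subspaceT => t; exact: is_derive_continuous (dG t).
- by move=> t tab; rewrite subr0; apply: fB; exact: subset_itv_oo_cc.
Qed.

Lemma within_continuous_section (R : realType) (A B : set R) (K : R -> R -> R) (s : R) :
  {within A `*` B, continuous (fun p : R * R => K p.1 p.2)} -> A s ->
  {within B, continuous (K s)}.
Proof.
move=> /subspace_continuousP cK As; apply/subspace_continuousP => t Bt.
apply: (@cvg_comp _ _ _ (fun y => (s, y)) (fun p : R * R => K p.1 p.2)
  _ (within (A `*` B) (nbhs (s, t)))); last exact: cK.
move=> P; rewrite /within /= => sP.
have cs : (fun _ : R => s) @ t --> s by exact: cvg_cst.
have ct : (fun y : R => y) @ t --> t by exact: cvg_id.
have : (fun y : R => (s, y)) @ t --> (s, t) by exact: (cvg_pair cs ct).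
move=> /(_ _ sP) h.
have {}h : nbhs t (fun y => (A `*` B) (s, y) -> P (s, y)) := h.
suff : nbhs t (fun y => B y -> P (s, y)) by [].
by apply: filterS h => y h By; exact: h.
Qed.

(** In this section G i stands for the i-th derivative of phi relative to
[x_0, x_k]. *)
Section scheme.
Variables (R : realType) (alpha h : R) (k : nat) (phi : R -> R) (G : nat -> R -> R).
Hypotheses (al01 : 0 < alpha < 1) (h0 : 0 < h).
Local Notation mu := (@lebesgue_measure R).
Local Notation x := (node h).
Hypothesis G0 : G 0%N = phi.
Hypothesis cG : forall i, (i <= 3)%N -> {within `[x 0, x k], continuous (G i)}.
Hypothesis dG : forall i t, (i < 3)%N -> t \in `]x 0, x k[ -> is_derive t 1 (G i) (G i.+1 t).

Let xlt j : x j < x j.+1. Proof. by rewrite nodeS ltrDl. Qed.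

Let cGs i j : (i <= 3)%N -> (j < k)%N -> {within `[x j, x j.+1], continuous (G i)}.
Proof.
move=> i3 jk; apply: continuous_subspaceW (cG i3); apply: subset_itv.
  by rewrite bnd_simp node_le.
by rewrite bnd_simp node_le.
Qed.

Let sub_oo j t : (j < k)%N -> t \in `]x j, x j.+1[ -> t \in `]x 0, x k[.
Proof.
move=> jk; rewrite !in_itv /= => /andP[t1 t2].
by rewrite (le_lt_trans (node_le h0 (leq0n j)) t1) (lt_le_trans t2 (node_le h0 jk)).
Qed.

Let dphiE j t : (j < k)%N -> t \in `]x j, x j.+1[ -> is_derive t 1 phi (G 1 t).
Proof. by move=> jk /(sub_oo jk) tx; rewrite -G0; exact: dG. Qed.

Let cphi j : (j < k)%N -> {within `[x j, x j.+1], continuous phi}.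
Proof. by move=> jk; rewrite -G0; exact: cGs. Qed.

Lemma lin_error j (M t : R) : (j < k)%N ->
  (forall y, y \in `[x j, x j.+1] -> `|G 2 y| <= M) ->
  t \in `[x j, x j.+1] ->
  `|phi t - lin_interp h phi j t| <= M / 2 * ((t - x j) * (x j.+1 - t)).
Proof.
move=> jk GM tj; apply: (lin_interp_error h0 G0 (a := x 0) (b := x k)) => //.
- exact: node_le.
- exact: node_le.
- by move=> i i1; apply: cG; exact: leq_trans i1 _.
- by move=> i y i1; apply: dG; exact: leq_ltn_trans i1 _.
Qed.

Lemma quad_error j (M t : R) : (j.+1 < k)%N ->
  (forall y, y \in `[x 0, x k] -> `|G 3 y| <= M) ->
  t \in `[x j.+1, x j.+2] ->
  `|phi t - quad_interp h phi j.+2 t| <=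
    M / 6 * ((t - x j) * (t - x j.+1) * (x j.+2 - t)).
Proof.
move=> jk GM tj; apply: (quad_interp_error h0 G0 (a := x 0) (b := x k)) => //.
- exact: node_le.
- exact: node_le.
- by move=> i i1; apply: cG; exact: leq_trans i1 _.
Qed.

Lemma kernel_error_le (kap : R -> R) (M M2 : R) : 0 <= M ->
  {within `[x 0, x k], continuous kap} ->
  (forall t, t \in `[x 0, x k] -> `|kap t| <= M) ->
  (forall t, t \in `[x 0, x k] -> `|G 2 t| <= M2) ->
  `|\sum_(0 <= j < k) \int[mu]_(t in `[x j, x j.+1])
     (kap t * (phi t - lin_interp h phi j t))| <= M / 2 * M2 * x k * h ^+ 2.
Proof.
move=> M0 ckap kapM GM.
have sub j t : (j < k)%N -> t \in `[x j, x j.+1] -> t \in `[x 0, x k].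
  move=> jk; rewrite !in_itv /= => /andP[t1 t2].
  by rewrite (le_trans (node_le h0 (leq0n j)) t1) (le_trans t2 (node_le h0 jk)).
have -> : M / 2 * M2 * x k * h ^+ 2 = \sum_(0 <= j < k) M / 2 * M2 * h ^+ 2 * h.
  by rewrite sumr_const_nat subn0 -mulr_natl /node; ring.
apply: le_trans (ler_norm_sum _ _ _) _; apply: ler_sum_nat => j /andP[_ jk].
have hE : x j.+1 - x j = h by rewrite nodeS addrAC subrr add0r.
rewrite -[X in _ <= _ * X]hE.
apply: Rintegral_bounded_le => //.
- move=> t; apply: cvgM.
    apply: continuous_subspaceW ckap t => y /=; exact: sub.
  apply: cvgB; first exact: cphi.
  have [q [_ qE]] := lin_interp_poly phi h0 j.
  rewrite (funext qE); apply: continuous_subspaceT; exact: continuous_horner.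
- move=> t tj; rewrite normrM.
  have := lin_error jk (fun y yj => GM y (sub _ _ jk yj)) tj.
  have M20 : 0 <= M2 by apply: le_trans (GM _ (sub _ _ jk tj)).
  move: (tj); rewrite in_itv /= nodeS => /andP[t1 t2] le1.
  have le2 : `|phi t - lin_interp h phi j t| <= M2 / 2 * h ^+ 2.
    apply: le_trans le1 _; apply: ler_wpM2l; first lra.
    by rewrite expr2; apply: ler_pM; lra.
  rewrite (_ : M / 2 * M2 * h ^+ 2 = M * (M2 / 2 * h ^+ 2)); last by ring.
  by apply: ler_pM => //; apply: kapM; exact: sub tj.
Qed.

Let bound_ge0 i (M : R) j : (forall t, t \in `[x 0, x j] -> `|G i t| <= M) -> 0 <= M.
Proof.
move=> GM; apply: le_trans (GM (x 0) _); first exact: normr_ge0.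
by rewrite in_itv /= lexx node_le.
Qed.

Lemma first_error_at (M : R) : k = 1%N ->
  (forall t, t \in `[x 0, x 1] -> `|G 2 t| <= M) ->
  `|\int[mu]_(t in `[x 0, x 1]) ((x 1 - t) `^ (- alpha) *
     derive_on `[x 0, x 1] (phi \- lin_interp h phi 0) t)| <=
  alpha / (2 * ((1 - alpha) * (2 - alpha))) * M * h `^ (2 - alpha).
Proof.
move=> k1 GM; have [q [_ qE]] := lin_interp_poly phi h0 0.
have k0 : (0 < k)%N by rewrite k1.
have hE : x 1 - x 0 = h by rewrite nodeS addrAC subrr add0r.
rewrite -[X in X `^ (2 - alpha)]hE.
apply: (caputo_error_lin_at al01 (xlt 0) (cphi k0) (cGs (i := 1) isT k0)
  (fun t => dphiE k0) qE _ (bound_ge0 GM)).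
  by rewrite lin_interp_node.
by move=> t; exact: lin_error.
Qed.

Lemma first_error_away (M : R) : (1 < k)%N ->
  (forall t, t \in `[x 0, x 1] -> `|G 2 t| <= M) ->
  `|\int[mu]_(t in `[x 0, x 1]) ((x k - t) `^ (- alpha) *
     derive_on `[x 0, x 1] (phi \- lin_interp h phi 0) t)| <=
  alpha / 12 * M * (x k - x 1) `^ (- alpha - 1) * h ^+ 3.
Proof.
move=> k1 GM; have [q [_ qE]] := lin_interp_poly phi h0 0.
have k0 : (0 < k)%N by exact: ltnW.
have xk : x 1 < x k by rewrite ltr_pM2r// ltr_nat.
have -> : h ^+ 3 = (x 1 - x 0) ^+ 3 by rewrite nodeS addrAC subrr add0r.
apply: (caputo_error_lin_away al01 (xlt 0) (ltW xk) (cphi k0) (cGs (i := 1) isT k0)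
  (fun t => dphiE k0) qE _ (bound_ge0 GM)) => //.
  by rewrite lin_interp_node.
by move=> t; exact: lin_error.
Qed.

Lemma middle_error (M : R) j : (j.+2 < k)%N ->
  (forall t, t \in `[x 0, x k] -> `|G 3 t| <= M) ->
  `|\int[mu]_(t in `[x j.+1, x j.+2]) ((x k - t) `^ (- alpha) *
     derive_on `[x j.+1, x j.+2] (phi \- quad_interp h phi j.+2) t)| <=
  M / 12 * h ^+ 3 * ((x k - x j.+2) `^ (- alpha) - (x k - x j.+1) `^ (- alpha)).
Proof.
move=> jk GM; have [q [_ qE]] := quad_interp_poly phi h0 j.+2.
have jk1 : (j.+1 < k)%N by exact: ltnW.
have xk : x j.+2 < x k by rewrite ltr_pM2r// ltr_nat.
have M0 := bound_ge0 GM.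
have bnd t : t \in `[x j.+1, x j.+2] -> `|phi t - quad_interp h phi j.+2 t| <=
    M / 6 * ((t - x j) * (t - x j.+1) * (x j.+2 - t)) by exact: quad_error.
apply: (caputo_error_mid al01 (xlt j.+1) (ltW xk) (cphi jk1) (cGs (i := 1) isT jk1)
  (fun t => dphiE jk1) qE) => //.
- by have [_ ->] := quad_interp_node phi h0 j.
- move=> t tj; apply: le_trans (bnd t tj) _.
  move: tj; rewrite in_itv /= !nodeS => /andP[t1 t2].
  (* t - x_j <= 2 h, and (t - x_(j+1)) (x_(j+2) - t) <= (h/2)^2. *)
  have -> : M / 12 * h ^+ 3 = M / 6 * (2 * h * (h ^+ 2 / 4)) by field.
  apply: ler_wpM2l; first lra.
  rewrite -mulrA; apply: ler_pM; [lra | by apply: mulr_ge0; lra | lra |].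
  by have := sqr_ge0 (2 * t - 2 * x j - 3 * h); nra.
- exists (M / 6 * (2 * h * h)) => t tj; apply: le_trans (bnd t tj) _.
  move: tj; rewrite in_itv /= !nodeS => /andP[t1 t2]; rewrite -[leRHS]mulrA.
  apply: ler_wpM2l; first lra.
  by apply: ler_wpM2r; [lra | apply: ler_pM; lra].
Qed.

Lemma last_error (M : R) j : k = j.+2 ->
  (forall t, t \in `[x 0, x k] -> `|G 3 t| <= M) ->
  `|\int[mu]_(t in `[x j.+1, x j.+2]) ((x k - t) `^ (- alpha) *
     derive_on `[x j.+1, x j.+2] (phi \- quad_interp h phi j.+2) t)| <=
  alpha / (3 * (1 - alpha) * (2 - alpha)) * (1 / 2 + 1 / (3 - alpha)) *
    M * h `^ (3 - alpha).
Proof.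
move=> kj GM; have [q [_ qE]] := quad_interp_poly phi h0 j.+2.
have jk1 : (j.+1 < k)%N by rewrite kj.
have hE : x j.+2 - x j.+1 = h by rewrite [x j.+2]nodeS addrAC subrr add0r.
rewrite -[X in _ <= _ * X `^ (3 - alpha)]hE [in x k]kj.
apply: (caputo_error_quad_at al01 (xlt j.+1) (cphi jk1) (cGs (i := 1) isT jk1)
  (fun t => dphiE jk1) qE _ (bound_ge0 GM)).
  by have [_ ->] := quad_interp_node phi h0 j.
move=> t tj; rewrite (_ : x j.+1 - (x j.+2 - x j.+1) = x j); last by rewrite !nodeS; ring.
exact: quad_error.
Qed.

(** The cells before the last telescope; with w_j = (x_k - x_j)^(-alpha) their sum
is a multiple of w_(k-1) - w_1, where w_(k-1) = h^(-alpha). *)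
Lemma quad_sum_error (M : R) : (1 < k)%N ->
  (forall t, t \in `[x 0, x k] -> `|G 3 t| <= M) ->
  `|\sum_(2 <= j < k.+1) \int[mu]_(t in `[x (j - 1), x j]) ((x k - t) `^ (- alpha) *
     derive_on `[x (j - 1), x j] (phi \- quad_interp h phi j) t)| <=
  (1 / 12 + alpha / (3 * (1 - alpha) * (2 - alpha)) * (1 / 2 + 1 / (3 - alpha))) *
    M * h `^ (3 - alpha).
Proof.
move=> k2 GM; rewrite big_nat_recr//=.
have M0 := bound_ge0 GM.
rewrite 2!mulrDl; apply: le_trans (ler_normD _ _) _; apply: lerD; last first.
  have [j kj] : exists j, k = j.+2 by case: k k2 => [|[|j]] // _; exists j.
  have last i : i = j.+2 -> `|\int[mu]_(t in `[x (i - 1), x i]) ((x k - t) `^ (- alpha) *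
     derive_on `[x (i - 1), x i] (phi \- quad_interp h phi i) t)| <=
     alpha / (3 * (1 - alpha) * (2 - alpha)) * (1 / 2 + 1 / (3 - alpha)) *
     M * h `^ (3 - alpha).
    by move=> ->; rewrite !subSS !subn0; exact: last_error kj GM.
  exact: last kj.
pose w j := (x k - x j) `^ (- alpha).
apply: (@le_trans _ _ (\sum_(2 <= j < k) M / 12 * h ^+ 3 * (w j - w j.-1))).
  apply: le_trans (ler_norm_sum _ _ _) _; apply: ler_sum_nat => -[|[|j]] // /andP[_ jk].
  by rewrite !subSS !subn0; exact: middle_error.
rewrite -big_distrr /= big_add1 telescope_sumr; last by rewrite -ltnS prednK// ltnW.
have wk : w k.-1 = h `^ (- alpha).
  rewrite /w -{1}(prednK (ltnW k2)) nodeS; congr (_ `^ _); ring.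
have h3 : h `^ (3 - alpha) = h ^+ 3 * h `^ (- alpha).
  rewrite powRD; last by apply/implyP => _; rewrite gt_eqF.
  by rewrite -powR_mulrn ?(ltW h0).
rewrite h3 wk.
have -> : 1 / 12 * M * (h ^+ 3 * h `^ (- alpha)) = M / 12 * h ^+ 3 * h `^ (- alpha) by field.
apply: ler_wpM2l.
  by rewrite mulr_ge0 ?divr_ge0 ?exprn_ge0 ?(ltW h0).
by rewrite lerBlDr lerDl powR_ge0.
Qed.

End scheme.

Theorem theorem4p3 (R : realType) (alpha : R) (n k : nat) (h M : R)
    (phi : R -> R) (K : R -> R -> R)
    (x := node h)
    (phi'' := derive_onn `[x 0%N, x k] 2 phi)
    (phi''' := derive_onn `[x 0%N, x k] 3 phi) :
  0 < alpha < 1 ->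
  (1 <= n)%N -> h = n%:R^-1 ->
  (1 <= k <= n)%N ->
  Cn_on `[x 0%N, x k] 3 phi ->
  {within `[0, 1] `*` `[0, 1], continuous (fun p : R * R => K p.1 p.2)} ->
  0 < M ->
  (forall s t : R, 0 <= s <= 1 -> 0 <= t <= 1 -> `|K s t| <= M) ->
  (k = 1%N ->
    `|scheme_error K 1 phi h alpha| <=
      alpha / (2 * Gamma (3 - alpha)) *
        max_on (x 0%N) (x 1%N) (fun t => `|phi'' t|) * h `^ (2 - alpha) +
      M / 2 * max_on (x 0%N) (x 1%N) (fun t => `|phi'' t|) * x 1%N * h ^+ 2) /\
  ((2 <= k)%N ->
    `|scheme_error K k phi h alpha| <=
      (alpha / 12 * max_on (x 0%N) (x 1%N) (fun t => `|phi'' t|) *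
         (x k - x 1%N) `^ (- alpha - 1) * h ^+ 3 +
       (1 / 12 + alpha / (3 * (1 - alpha) * (2 - alpha)) *
                 (1 / 2 + 1 / (3 - alpha))) *
         max_on (x 0%N) (x k)
           (fun t => 1 / Gamma (1 - alpha) * `|phi''' t|) *
         h `^ (3 - alpha)) +
      M / 2 * max_on (x 0%N) (x k) (fun t => `|phi'' t|) * x k * h ^+ 2).
Proof.
move=> al01 n1 hE /andP[k1 kn] Cphi cK M0 KM.
have /andP[al0 al1] := al01.
have h0 : 0 < h by rewrite hE invr_gt0 ltr0n.
have x00 : x 0%N = 0 by rewrite /x /node mul0r.
have xk1 : x k <= 1.
  by rewrite /x /node hE ler_pdivrMr ?ltr0n// mul1r ler_nat.
have xk0 : 0 < x k by rewrite /x /node mulr_gt0// ltr0n.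
pose G i := derive_onn `[x 0%N, x k] i phi.
have [cG dG] := Cn_on_chain Cphi.
have cnG i : (i <= 3)%N -> {within `[x 0%N, x k], continuous (fun t => `|G i t|)}.
  by move=> i3 t; apply: cvg_norm; exact: cG.
have G2le a b t : x 0%N <= a -> b <= x k -> t \in `[a, b]%R ->
    `|G 2 t| <= max_on a b (fun t => `|phi'' t|).
  by move=> xa bx tab; apply: (le_max_on xa bx (cnG 2%N isT) tab).
have cKx : {within `[x 0%N, x k], continuous (K (x k))}.
  apply: continuous_subspaceW (within_continuous_section cK _).
    apply: subset_itv; rewrite bnd_simp//.
    by rewrite x00.
  by rewrite /= in_itv /= (ltW xk0).
have KMx t : t \in `[x 0%N, x k] -> `|K (x k) t| <= M.
  rewrite in_itv /= x00 => /andP[t0 t1]; apply: KM; first by rewrite (ltW xk0).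
  by rewrite t0 (le_trans t1 xk1).
have kernel := kernel_error_le (phi := phi) (G := G) h0 erefl cG dG (ltW M0) cKx KMx
  (fun t => @G2le _ _ t (lexx _) (lexx _)).
have Ga1 := Gamma_ge1 al01.
have g0 := lt_le_trans ltr01 Ga1.
split.
- move=> k1E; subst k; rewrite /scheme_error big_geq// addr0.
  have first := first_error_at (phi := phi) (G := G) al01 h0 erefl cG dG erefl
    (fun t => @G2le _ _ t (lexx _) (lexx _)).
  apply: le_trans (ler_normB _ _) _; apply: lerD; last exact: kernel.
  rewrite normrM gtr0_norm ?invr_gt0//.
  have -> : alpha / (2 * Gamma (3 - alpha)) * max_on (x 0%N) (x 1%N) (fun t => `|phi'' t|) *
      h `^ (2 - alpha) = (Gamma (1 - alpha))^-1 *
      (alpha / (2 * ((1 - alpha) * (2 - alpha))) *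
       max_on (x 0%N) (x 1%N) (fun t => `|phi'' t|) * h `^ (2 - alpha)).
    have a1 : 1 - alpha != 0 by rewrite subr_eq0 gt_eqF.
    have a2 : 2 - alpha != 0 by rewrite subr_eq0 gt_eqF// (lt_trans al1)// ltr1n.
    rewrite (Gamma_3B al01); field.
    by rewrite a1 a2 (gt_eqF g0).
  by rewrite ler_pM2l ?invr_gt0.
- move=> k2.
  pose Mx := max_on (x 0%N) (x k) (fun t => 1 / Gamma (1 - alpha) * `|phi''' t|).
  (* The stated maximum carries the factor 1 / Gamma(1 - alpha); M3 undoes it. *)
  pose M3 := Gamma (1 - alpha) * Mx.
  have GM3 t : t \in `[x 0%N, x k] -> `|G 3 t| <= M3.
    move=> tx; rewrite /M3 -ler_pdivrMl// -[X in X * _]div1r.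
    have := @le_max_on _ _ _ _ _ (fun t => 1 / Gamma (1 - alpha) * `|phi''' t|)
      t (lexx (x 0%N)) (lexx (x k)) _ tx.
    apply => s; apply: cvgM; first exact: cvg_cst.
    exact: cnG.
  have first := first_error_away (phi := phi) (G := G) al01 h0 erefl cG dG k2
    (fun t => @G2le _ _ t (lexx _) (node_le h0 (ltnW k2))).
  have quads := quad_sum_error (phi := phi) (G := G) al01 h0 erefl cG dG k2 GM3.
  rewrite {1}/scheme_error.
  apply: le_trans (ler_normB _ _) _; apply: lerD; last exact: kernel.
  rewrite normrM gtr0_norm ?invr_gt0// ler_pdivrMl//.
  apply: le_trans (ler_normD _ _) _; rewrite mulrDr; apply: lerD.
    (* The factor 1 / Gamma(1 - alpha) is dropped here, as Gamma(1 - alpha) >= 1. *)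
    apply: le_trans first _; apply: ler_peMl => //.
    have m0 : 0 <= max_on (x 0%N) (x 1%N) (fun t => `|phi'' t|).
      apply: le_trans (@G2le _ _ (x 0%N) (lexx _) (node_le h0 (ltnW k2)) _) => //.
      by rewrite in_itv /= lexx node_le.
    have al12 : 0 <= alpha / 12 by rewrite divr_ge0// ltW.
    exact: mulr_ge0 (mulr_ge0 (mulr_ge0 al12 m0) (powR_ge0 _ _)) (exprn_ge0 3 (ltW h0)).
  apply: le_trans quads _; rewrite le_eqVlt; apply/orP; left; apply/eqP.
  by rewrite /M3 -/Mx; ring.
Qed.
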